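(* The category $\mathbf{Gpd}^{\mathbf{G}}$, equipped with the subcategory given by projective fibrations (the morphisms whose underlying functor of groupoids is an isofibration), is a type-theoretic fibration category.
   Context: $\mathbf{Gpd}^{\mathbf{G}}$ is the category of groupoids equipped with an involution and functors commuting with the involutions (the functor category $[\mathbf{B}(\mathbb{Z}/2\mathbb{Z})^{op},\mathbf{Gpd}]$). A type-theoretic fibration category (Shulman) is a category $\mathscr{C}$ with: (1) a terminal object $1$; (2) a subcategory $\mathcal{F}$ (fibrations) containing all objects, all isomorphisms and all morphisms with codomain $1$; a morphism is an acyclic cofibration if it has the left lifting property with respect to all fibrations; (3) all pullbacks of fibrations exist and are fibrations; (4) for every fibration $g:A\to B$ the pullback functor $g^*:\mathscr{C}/B\to\mathscr{C}/A$ has a partial right adjoint $\Pi_g$ defined at all fibrations over $A$, whose values are fibrations over $B$; (5) every morphism factors as an acyclic cofibration followed by a fibration; (6) given fibrations $B\to C$ and $A\to C$ and an acyclic cofibration $A\to B$ over $C$, and any morphism $Z\to C$, with $Y=Z\times_C B$ and $X=Y\times_B A$ (two pullback squares), the induced map $X\to Y$ is an acyclic cofibration. *)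

(* Defs.v *)
Set Implicit Arguments.
Unset Strict Implicit.

Record Groupoid := {
  gob :> Type;
  ghom : gob -> gob -> Type;
  gid : forall a, ghom a a;
  gcomp : forall a b c, ghom b c -> ghom a b -> ghom a c;
  ginv : forall a b, ghom a b -> ghom b a;
  gcomp_assoc : forall a b c d (h : ghom c d) (g : ghom b c) (f : ghom a b),
      gcomp h (gcomp g f) = gcomp (gcomp h g) f;
  gcomp_id_l : forall a b (f : ghom a b), gcomp (gid b) f = f;
  gcomp_id_r : forall a b (f : ghom a b), gcomp f (gid a) = f;
  ginv_l : forall a b (f : ghom a b), gcomp (ginv f) f = gid a;
  ginv_r : forall a b (f : ghom a b), gcomp f (ginv f) = gid b }.

Arguments ghom {_} _ _.
Arguments gid {_} _.
Arguments gcomp {_ _ _ _} _ _.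
Arguments ginv {_ _ _} _.

Record Functor (G H : Groupoid) := {
  fobj :> G -> H;
  fmap : forall a b : G, ghom a b -> ghom (fobj a) (fobj b);
  fmap_id : forall a : G, fmap (gid a) = gid (fobj a);
  fmap_comp : forall (a b c : G) (g : ghom b c) (f : ghom a b),
      fmap (gcomp g f) = gcomp (fmap g) (fmap f) }.

Arguments fmap {G H} _ {a b} _.

Definition eq_hom (G : Groupoid) (a b : G) (e : a = b) : ghom a b :=
  match e in _ = b' return ghom a b' with eq_refl => gid a end.

(** Equality of functors (strict equality in the 1-category Gpd):
    equal object maps, and equal morphism maps modulo the transport along
    the object equalities. *)
Definition feq (G H : Groupoid) (F1 F2 : Functor G H) : Prop :=
  exists e : forall x : G, F1 x = F2 x,
    forall (a b : G) (f : ghom a b),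
      gcomp (fmap F2 f) (eq_hom (e a)) = gcomp (eq_hom (e b)) (fmap F1 f).

Program Definition fid (G : Groupoid) : Functor G G :=
  {| fobj := fun x => x; fmap := fun a b f => f |}.
Next Obligation. reflexivity. Qed.
Next Obligation. reflexivity. Qed.

Program Definition fcomp (G H K : Groupoid) (F2 : Functor H K) (F1 : Functor G H)
  : Functor G K :=
  {| fobj := fun x => F2 (F1 x); fmap := fun a b f => fmap F2 (fmap F1 f) |}.
Next Obligation. intros; cbn. now rewrite !fmap_id. Qed.
Next Obligation. intros; cbn. now rewrite !fmap_comp. Qed.

Definition isofibration (G H : Groupoid) (F : Functor G H) : Prop :=
  forall (x : G) (y : H) (f : ghom (F x) y),
    exists (x' : G) (g : ghom x x') (e : F x' = y),
      gcomp (eq_hom e) (fmap F g) = f.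

(** * Groupoids with involution = functors B(Z/2)^op -> Gpd *)

Record GpdInv := {
  gi_gpd :> Groupoid;
  gi_inv : Functor gi_gpd gi_gpd;
  gi_inv_inv : feq (fcomp gi_inv gi_inv) (fid gi_gpd) }.

Definition commutes_inv (X Y : GpdInv) (F : Functor X Y) : Prop :=
  feq (fcomp F (gi_inv X)) (fcomp (gi_inv Y) F).

Lemma eq_hom_trans (G : Groupoid) (a b c : G) (p : a = b) (q : b = c) :
  eq_hom (eq_trans p q) = gcomp (eq_hom q) (eq_hom p).
Proof. destruct p, q; simpl. now rewrite gcomp_id_l. Qed.

Lemma eq_hom_fmap (G H : Groupoid) (F : Functor G H) (a b : G) (p : a = b) :
  eq_hom (f_equal F p) = fmap F (eq_hom p).
Proof. destruct p; simpl. now rewrite fmap_id. Qed.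

Lemma commutes_inv_id (X : GpdInv) : commutes_inv (fid X).
Proof.
  exists (fun x => eq_refl). intros a b f; simpl.
  now rewrite gcomp_id_l, gcomp_id_r.
Qed.

Lemma commutes_inv_comp (X Y Z : GpdInv) (G : Functor Y Z) (F : Functor X Y) :
  commutes_inv G -> commutes_inv F -> commutes_inv (fcomp G F).
Proof.
  intros [e2 n2] [e1 n1].
  exists (fun x => eq_trans (f_equal G (e1 x)) (e2 (F x))).
  intros a b f; simpl in *.
  rewrite !eq_hom_trans, !eq_hom_fmap.
  rewrite gcomp_assoc, (n2 _ _ (fmap F f)).
  rewrite <- !gcomp_assoc, <- !fmap_comp, (n1 _ _ f).
  now rewrite fmap_comp.
Qed.

Definition GHom (X Y : GpdInv) : Type :=
  { F : Functor X Y | commutes_inv F }.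

Definition GHom_fun (X Y : GpdInv) (F : GHom X Y) : Functor X Y := proj1_sig F.

Record CatData := {
  Ob : Type;
  Hom : Ob -> Ob -> Type;
  heq : forall a b, Hom a b -> Hom a b -> Prop;
  idm : forall a, Hom a a;
  comp : forall a b c, Hom b c -> Hom a b -> Hom a c }.

Arguments heq {_ _ _} _ _.
Arguments idm {_} _.
Arguments Hom : clear implicits.
Arguments comp {_ _ _ _} _ _.

Infix "≈" := heq (at level 70).
Infix "⊙" := comp (at level 40, left associativity).

Definition GpdG : CatData := {|
  Ob := GpdInv;
  Hom := GHom;
  heq := fun X Y F1 F2 => feq (GHom_fun F1) (GHom_fun F2);
  idm := fun X => exist _ (fid X) (commutes_inv_id X);
  comp := fun X Y Z G F =>
    exist _ (fcomp (GHom_fun G) (GHom_fun F))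
      (commutes_inv_comp (proj2_sig G) (proj2_sig F)) |}.

Definition projective_fib (X Y : Ob GpdG) (F : Hom GpdG X Y) : Prop :=
  isofibration (GHom_fun F).

Section CatDefs.
Variable C : CatData.

Definition is_category : Prop :=
  (forall a b (f : Hom C a b), f ≈ f) /\
  (forall a b (f g : Hom C a b), f ≈ g -> g ≈ f) /\
  (forall a b (f g h : Hom C a b), f ≈ g -> g ≈ h -> f ≈ h) /\
  (forall a b c (f f' : Hom C a b) (g g' : Hom C b c),
      f ≈ f' -> g ≈ g' -> g ⊙ f ≈ g' ⊙ f') /\
  (forall a b c d (f : Hom C a b) (g : Hom C b c) (h : Hom C c d),
      h ⊙ (g ⊙ f) ≈ (h ⊙ g) ⊙ f) /\
  (forall a b (f : Hom C a b), idm b ⊙ f ≈ f) /\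
  (forall a b (f : Hom C a b), f ⊙ idm a ≈ f).

Definition is_terminal (t : Ob C) : Prop :=
  forall x, exists f : Hom C x t, forall g : Hom C x t, g ≈ f.

Definition is_iso (a b : Ob C) (f : Hom C a b) : Prop :=
  exists g : Hom C b a, g ⊙ f ≈ idm a /\ f ⊙ g ≈ idm b.

Definition is_pullback (A B D P : Ob C) (f : Hom C A D) (g : Hom C B D)
    (pa : Hom C P A) (pb : Hom C P B) : Prop :=
  f ⊙ pa ≈ g ⊙ pb /\
  forall W (u : Hom C W A) (v : Hom C W B), f ⊙ u ≈ g ⊙ v ->
    exists k : Hom C W P, pa ⊙ k ≈ u /\ pb ⊙ k ≈ v /\
      forall k' : Hom C W P, pa ⊙ k' ≈ u -> pb ⊙ k' ≈ v -> k' ≈ k.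

Variable Fib : forall a b, Hom C a b -> Prop.

Definition llp (A B X Y : Ob C) (i : Hom C A B) (p : Hom C X Y) : Prop :=
  forall (u : Hom C A X) (v : Hom C B Y), p ⊙ u ≈ v ⊙ i ->
    exists h : Hom C B X, h ⊙ i ≈ u /\ p ⊙ h ≈ v.

Definition acyclic_cof (A B : Ob C) (i : Hom C A B) : Prop :=
  forall X Y (p : Hom C X Y), Fib p -> llp i p.

Definition is_ttfc : Prop :=
  is_category /\
  (exists t, is_terminal t /\ forall X (f : Hom C X t), Fib f) /\
  (forall a b (f g : Hom C a b), f ≈ g -> Fib f -> Fib g) /\
  (forall a, Fib (idm a)) /\
  (forall a b c (f : Hom C a b) (g : Hom C b c), Fib f -> Fib g -> Fib (g ⊙ f)) /\
  (forall a b (f : Hom C a b), is_iso f -> Fib f) /\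
  (forall A B D (p : Hom C A D) (h : Hom C B D), Fib p ->
     exists P (p1 : Hom C P B) (p2 : Hom C P A), is_pullback h p p1 p2) /\
  (forall A B D P (p : Hom C A D) (h : Hom C B D) (p1 : Hom C P B) (p2 : Hom C P A),
     Fib p -> is_pullback h p p1 p2 -> Fib p1) /\
  (* (4) dependent products: partial right adjoint Pi_g to g^*, defined at
     fibrations over A, with values fibrations over B.  Pi_g q is given by a
     fibration r : P -> B together with a pullback Q of r along g and a counit
     eps : g^*(r) -> q over A, universal among maps g^*(h) -> q over A. *)
  (forall A B (g : Hom C A B), Fib g ->
   forall E (q : Hom C E A), Fib q ->
   exists P (r : Hom C P B) Q (gP : Hom C Q P) (r' : Hom C Q A) (eps : Hom C Q E),
     Fib r /\ is_pullback r g gP r' /\ q ⊙ eps ≈ r' /\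
     forall X (h : Hom C X B) Y (gX : Hom C Y X) (h' : Hom C Y A),
       is_pullback h g gX h' ->
       forall phi : Hom C Y E, q ⊙ phi ≈ h' ->
       exists k : Hom C X P,
         r ⊙ k ≈ h /\
         (forall k' : Hom C Y Q, gP ⊙ k' ≈ k ⊙ gX -> r' ⊙ k' ≈ h' -> eps ⊙ k' ≈ phi) /\
         (forall k2 : Hom C X P, r ⊙ k2 ≈ h ->
            (forall k' : Hom C Y Q, gP ⊙ k' ≈ k2 ⊙ gX -> r' ⊙ k' ≈ h' -> eps ⊙ k' ≈ phi) ->
            k2 ≈ k)) /\
  (forall X Y (f : Hom C X Y),
     exists Z (i : Hom C X Z) (p : Hom C Z Y), acyclic_cof i /\ Fib p /\ p ⊙ i ≈ f) /\
  (forall A B D (p : Hom C B D) (q : Hom C A D) (i : Hom C A B),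
     Fib p -> Fib q -> acyclic_cof i -> p ⊙ i ≈ q ->
     forall Z (z : Hom C Z D) Y (y1 : Hom C Y Z) (y2 : Hom C Y B),
       is_pullback z p y1 y2 ->
       forall X (x1 : Hom C X Y) (x2 : Hom C X A),
         is_pullback y2 i x1 x2 -> acyclic_cof x1).

End CatDefs.
Arguments is_ttfc : clear implicits.

(* Main.v *)
(* A groupoid with involution is encoded by its set of arrows, objects being
   identity arrows. Functors then become functions on arrows and strict equality
   of functors becomes pointwise equality, so that all the axioms can be checked
   on elements.

   The crucial point is an elementary description of the acyclic cofibrations:
   they are the fully faithful functors, injective on objects, such that every
   object outside the image is isomorphic to an object of the image and is moved
   by the involution. Given this freeness, lifts through an isofibration are chosen
   on one object of each two-element orbit and transported to the other one. The
   mapping path object of [f : X -> Y], made free by doubling its objects and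
   adding back a copy of [X], yields the factorization, and a section of it extracts
   the description from the lifting property. The description is stable under
   pullback along a base change, using lifts of isomorphisms in the fibration
   [A -> C]. *)

From Stdlib Require Import Classical ClassicalEpsilon FunctionalExtensionality.
From Stdlib Require Import PropExtensionality ProofIrrelevance.
Require Import Defs.

Set Implicit Arguments.
Unset Strict Implicit.

(** * Groupoids with involution presented by their arrows *)

(** Freeness answers an obstruction: a projective fibration lifts isomorphisms, but it promises no
    lift that the involution fixes, so a fixed object outside the image could rule out an
    equivariant diagonal. Dependent products need an idea of their own. An object over [b] should be
    a section of [q] over the fibre of [g] at [b], and an arrow a natural isomorphism between two
    such sections; as dependent functions on fibres these would bring the transports back. They are
    stored instead as subsets of [E], namely their values on all arrows of [A] above [b].
    Composition becomes the elementwise product of subsets, inverse and involution act elementwise,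
    and associativity is inherited from [E]. Lifting isomorphisms along [g] splits an arrow above a
    composite into arrows above the factors, so that a product of sections is again a section. Since
    a fibration demands nothing equivariant, the lifts that make the dependent product fibrant are
    chosen arbitrarily. *)

(* [src u] and [tgt u] are the identities at the ends of [u]; [cmp] composes in
   diagrammatic order and is meaningless unless [tgt u = src v]. *)
Record AGpd := {
  ar :> Type;
  src : ar -> ar;
  tgt : ar -> ar;
  cmp : ar -> ar -> ar;
  inv : ar -> ar;
  sig : ar -> ar;
  src_src : forall u, src (src u) = src u;
  tgt_src : forall u, tgt (src u) = src u;
  src_tgt : forall u, src (tgt u) = tgt u;
  tgt_tgt : forall u, tgt (tgt u) = tgt u;
  src_cmp : forall u v, tgt u = src v -> src (cmp u v) = src u;
  tgt_cmp : forall u v, tgt u = src v -> tgt (cmp u v) = tgt v;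
  cmp_assoc : forall u v w, tgt u = src v -> tgt v = src w ->
    cmp (cmp u v) w = cmp u (cmp v w);
  cmp_src : forall u, cmp (src u) u = u;
  cmp_tgt : forall u, cmp u (tgt u) = u;
  src_inv : forall u, src (inv u) = tgt u;
  tgt_inv : forall u, tgt (inv u) = src u;
  cmp_inv_r : forall u, cmp u (inv u) = src u;
  cmp_inv_l : forall u, cmp (inv u) u = tgt u;
  sig_sig : forall u, sig (sig u) = u;
  sig_src : forall u, sig (src u) = src (sig u);
  sig_tgt : forall u, sig (tgt u) = tgt (sig u);
  sig_cmp : forall u v, tgt u = src v -> sig (cmp u v) = cmp (sig u) (sig v) }.

Arguments src {_} _.
Arguments tgt {_} _.
Arguments cmp {_} _ _.
Arguments inv {_} _.
Arguments sig {_} _.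

Record AHom (X Y : AGpd) := {
  amap :> X -> Y;
  amap_src : forall u, amap (src u) = src (amap u);
  amap_tgt : forall u, amap (tgt u) = tgt (amap u);
  amap_cmp : forall u v, tgt u = src v -> amap (cmp u v) = cmp (amap u) (amap v);
  amap_sig : forall u, amap (sig u) = sig (amap u) }.

Create HintDb agpd.
Global Hint Rewrite src_src tgt_src src_tgt tgt_tgt src_inv tgt_inv cmp_src cmp_tgt
  cmp_inv_r cmp_inv_l sig_sig amap_sig : agpd.
Global Hint Rewrite <- sig_src sig_tgt amap_src amap_tgt : agpd.

(** Normal forms have [src] and [tgt] pushed inward past [sig] and homomorphisms. The two tactics
    are mutually recursive because rewriting an end of a composite raises a composability condition,
    itself settled by normalising. *)
Ltac gside := solve [congruence | agpd; congruence]
with agpd := repeat first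
  [ progress autorewrite with agpd in *
  | rewrite src_cmp by gside | rewrite tgt_cmp by gside
  | rewrite sig_cmp by gside | rewrite amap_cmp by gside ].

Section Calculus.
Variable X : AGpd.
Implicit Types u v w : X.

Lemma cmp_obj_l u v : src u = u -> u = src v -> cmp u v = v.
Proof. intros H ->. apply cmp_src. Qed.

Lemma cmp_K u v : src u = src v -> cmp u (cmp (inv u) v) = v.
Proof. intros H. rewrite <- cmp_assoc by gside. rewrite cmp_inv_r, H. apply cmp_src. Qed.

Lemma cmp_VK u v : tgt u = src v -> cmp (inv u) (cmp u v) = v.
Proof. intros H. rewrite <- cmp_assoc by gside. rewrite cmp_inv_l, H. apply cmp_src. Qed.

Lemma inv_unique u v : tgt u = src v -> cmp u v = src u -> v = inv u.
Proof.
  intros H E. rewrite <- (cmp_VK H), E, <- tgt_inv. apply cmp_tgt.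
Qed.

Lemma inv_inv u : inv (inv u) = u.
Proof. symmetry; apply inv_unique; agpd; congruence. Qed.

Lemma inv_obj u : src u = u -> inv u = u.
Proof.
  intros H. assert (tgt u = u) by (rewrite <- H at 1; agpd; congruence).
  symmetry; apply inv_unique; try congruence. rewrite <- H at 1. now rewrite cmp_src.
Qed.

Lemma inv_cmp u v : tgt u = src v -> inv (cmp u v) = cmp (inv v) (inv u).
Proof.
  intros H. symmetry; apply inv_unique; agpd; try congruence.
  rewrite cmp_assoc by gside. rewrite cmp_K by gside. now rewrite cmp_inv_r.
Qed.

Lemma tgt_obj u : src u = u -> tgt u = u.
Proof. intros H. rewrite <- H. now rewrite tgt_src. Qed.

Lemma sig_inv u : sig (inv u) = inv (sig u).
Proof.
  apply inv_unique; [gside|]. rewrite <- sig_cmp by gside. agpd. congruence.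
Qed.

Lemma sig_obj u : src u = u -> src (sig u) = sig u.
Proof. intros H. now rewrite <- sig_src, H. Qed.

Lemma cmp_cancel_l u v w : tgt u = src v -> tgt u = src w -> cmp u v = cmp u w -> v = w.
Proof.
  intros Hv Hw E. now rewrite <- (cmp_VK Hv), E, cmp_VK.
Qed.

Lemma cmp_cancel_r u v w : tgt v = src u -> tgt w = src u -> cmp v u = cmp w u -> v = w.
Proof.
  intros Hv Hw E. assert (cmp (cmp v u) (inv u) = cmp (cmp w u) (inv u)) as E' by now rewrite E.
  rewrite !cmp_assoc, cmp_inv_r, <- Hv, cmp_tgt, Hv, <- Hw, cmp_tgt in E' by gside.
  exact E'.
Qed.
End Calculus.

Lemma amap_inv (X Y : AGpd) (f : AHom X Y) u : f (inv u) = inv (f u).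
Proof.
  apply inv_unique; [gside|]. rewrite <- amap_cmp by gside. agpd. congruence.
Qed.

Lemma amap_obj (X Y : AGpd) (f : AHom X Y) u : src u = u -> src (f u) = f u.
Proof. intros H. now rewrite <- amap_src, H. Qed.


Global Hint Rewrite inv_inv sig_inv amap_inv : agpd.

Definition comp_ahom (X Y Z : AGpd) (g : AHom Y Z) (f : AHom X Y) : AHom X Z.
Proof.
  refine {| amap := fun u => g (f u) |}; intros; agpd; congruence.
Defined.

(** * Arrows of a groupoid *)

Record Arr (G : Groupoid) := mkArr { adom : G; acod : G; ahom : ghom adom acod }.
Arguments mkArr {G adom acod} _.
Arguments adom {G} _.
Arguments acod {G} _.
Arguments ahom {G} _.

Section Arrows.
Variable G : Groupoid.

Lemma mkArr_eq_cast (a a' b b' : G) (ea : a = a') (eb : b = b')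
    (f : ghom a b) (f' : ghom a' b') :
  gcomp f' (eq_hom ea) = gcomp (eq_hom eb) f -> mkArr f = mkArr f'.
Proof.
  destruct ea, eb; simpl. rewrite gcomp_id_l, gcomp_id_r. now intros ->.
Qed.

Lemma Arr_eq_cast (u v : Arr G) (ea : adom u = adom v) (eb : acod u = acod v) :
  u = v -> gcomp (ahom v) (eq_hom ea) = gcomp (eq_hom eb) (ahom u).
Proof.
  intros E; destruct E.
  rewrite (proof_irrelevance _ ea eq_refl), (proof_irrelevance _ eb eq_refl); simpl.
  now rewrite gcomp_id_l, gcomp_id_r.
Qed.

Lemma mkArr_inj (a b : G) (f f' : ghom a b) : mkArr f = mkArr f' -> f = f'.
Proof.
  intros E. generalize (Arr_eq_cast (u := mkArr f) (v := mkArr f') eq_refl eq_refl E); simpl.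
  now rewrite gcomp_id_l, gcomp_id_r.
Qed.

Lemma mkArr_cast (a a' b b' : G) (ea : a' = a) (eb : b = b') (f : ghom a b) :
  mkArr (gcomp (eq_hom eb) (gcomp f (eq_hom ea))) = mkArr f.
Proof. destruct ea, eb; simpl. now rewrite gcomp_id_l, gcomp_id_r. Qed.

Lemma mkArr_gid_inj (a b : G) : mkArr (gid a) = mkArr (gid b) -> a = b.
Proof. intros E. exact (f_equal adom E). Qed.

(** Composability is decided classically; the junk value [u] is harmless, since every law of [AGpd]
    speaks of composable arrows. *)
Definition acomp (u v : Arr G) : Arr G :=
  match excluded_middle_informative (acod u = adom v) with
  | left e => mkArr (gcomp (ahom v) (gcomp (eq_hom e) (ahom u)))
  | right _ => u
  end.

Lemma acompE (a b c : G) (f : ghom a b) (g : ghom b c) :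
  acomp (mkArr f) (mkArr g) = mkArr (gcomp g f).
Proof.
  unfold acomp; simpl. destruct excluded_middle_informative as [e|n]; [|now destruct n].
  rewrite (proof_irrelevance _ e eq_refl); simpl. now rewrite gcomp_id_l.
Qed.
End Arrows.

(** An [Arr] carries its ends, so equality of arrows absorbs the casts of [feq]. Conversely the
    object equalities are read off at identities, and proof irrelevance makes their choice
    immaterial. *)
Lemma feqE (G H : Groupoid) (F1 F2 : Functor G H) :
  feq F1 F2 <-> forall u : Arr G, mkArr (fmap F1 (ahom u)) = mkArr (fmap F2 (ahom u)).
Proof.
  split.
  - intros [e n] [a b f]; simpl. exact (mkArr_eq_cast (ea := e a) (eb := e b) (n a b f)).
  - intros E.
    assert (e : forall x, F1 x = F2 x).
    { intros x. exact (f_equal adom (E (mkArr (gid x)))). }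
    exists e. intros a b f. apply (Arr_eq_cast (u := mkArr _) (v := mkArr _)), (E (mkArr f)).
Qed.

Definition arrows (X : GpdInv) : AGpd.
Proof.
  refine {| ar := Arr X;
    src := fun u => mkArr (gid (adom u)); tgt := fun u => mkArr (gid (acod u));
    cmp := @acomp X; inv := fun u => mkArr (ginv (ahom u));
    sig := fun u => mkArr (fmap (gi_inv X) (ahom u)) |};
  try reflexivity.
  - intros [a b f] [c d g] E; apply mkArr_gid_inj in E; simpl in E; subst. now rewrite acompE.
  - intros [a b f] [c d g] E; apply mkArr_gid_inj in E; simpl in E; subst. now rewrite acompE.
  - intros [a b f] [c d g] [c' d' h] E E'; apply mkArr_gid_inj in E, E'; simpl in E, E'; subst.
    now rewrite !acompE, gcomp_assoc.
  - intros [a b f]; simpl. now rewrite acompE, gcomp_id_r.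
  - intros [a b f]; simpl. now rewrite acompE, gcomp_id_l.
  - intros [a b f]; simpl. now rewrite acompE, ginv_l.
  - intros [a b f]; simpl. now rewrite acompE, ginv_r.
  - intros [a b f]. exact (proj1 (feqE _ _) (gi_inv_inv X) (mkArr f)).
  - intros [a b f]; simpl. now rewrite fmap_id.
  - intros [a b f]; simpl. now rewrite fmap_id.
  - intros [a b f] [c d g] E; apply mkArr_gid_inj in E; simpl in E; subst.
    rewrite !acompE; simpl; now rewrite fmap_comp.
Defined.

Definition arrow_map (X Y : Ob GpdG) (F : Hom GpdG X Y) : AHom (arrows X) (arrows Y).
Proof.
  refine {| amap := fun u : arrows X =>
    (mkArr (fmap (GHom_fun F) (ahom u)) : arrows Y) |}.
  - intros [a b f]; simpl. now rewrite fmap_id.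
  - intros [a b f]; simpl. now rewrite fmap_id.
  - intros [a b f] [c d g] E; apply mkArr_gid_inj in E; simpl in E; subst; simpl.
    rewrite !acompE; simpl; now rewrite fmap_comp.
  - intros u. exact (proj1 (feqE _ _) (proj2_sig F) u).
Defined.

Lemma heqE (X Y : Ob GpdG) (F1 F2 : Hom GpdG X Y) :
  F1 ≈ F2 <-> forall u, arrow_map F1 u = arrow_map F2 u.
Proof. apply feqE. Qed.

Lemma arrow_map_id (X : Ob GpdG) u : arrow_map (idm X) u = u.
Proof. now destruct u. Qed.

Lemma arrow_map_comp (X Y Z : Ob GpdG) (g : Hom GpdG Y Z) (f : Hom GpdG X Y) u :
  arrow_map (g ⊙ f) u = arrow_map g (arrow_map f u).
Proof. reflexivity. Qed.

Lemma arrow_map_full (X Y : Ob GpdG) (m : AHom (arrows X) (arrows Y)) :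
  exists F : Hom GpdG X Y, forall u, arrow_map F u = m u.
Proof.
  set (o := fun x : X => adom (m (mkArr (gid x)) : Arr Y)).
  assert (Hd : forall a b (f : ghom a b), o a = adom (m (mkArr f) : Arr Y)).
  { intros a b f. exact (f_equal adom (amap_src m (mkArr f))). }
  assert (Hc : forall a b (f : ghom a b), acod (m (mkArr f) : Arr Y) = o b).
  { intros a b f. exact (eq_sym (f_equal adom (amap_tgt m (mkArr f)))). }
  (* The ends of [m (mkArr f)] are [o a] and [o b] only up to propositional equality, hence the
     casts, which disappear again under [mkArr]. *)
  set (fm := fun a b (f : ghom a b) => gcomp (eq_hom (Hc a b f))
     (gcomp (ahom (m (mkArr f) : Arr Y)) (eq_hom (Hd a b f)))).
  assert (E : forall a b (f : ghom a b), mkArr (fm a b f) = m (mkArr f)).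
  { intros a b f. unfold fm. rewrite mkArr_cast. now destruct (m (mkArr f) : Arr Y). }
  assert (Hi : forall a, fm a a (gid a) = gid (o a)).
  { intros a. apply mkArr_inj. rewrite E.
    exact (amap_src m (mkArr (gid a))). }
  assert (Hm : forall a b c (g : ghom b c) (f : ghom a b),
     fm a c (gcomp g f) = gcomp (fm b c g) (fm a b f)).
  { intros a b c g f. apply mkArr_inj. rewrite <- acompE, !E, <- acompE.
    exact (amap_cmp m (u := mkArr f) (v := mkArr g) eq_refl). }
  set (F := Build_Functor Hi Hm).
  assert (EF : forall u, mkArr (fmap F (ahom u)) = m u) by (intros [a b f]; exact (E a b f)).
  assert (HF : @commutes_inv X Y F).
  { apply feqE. intros u.
    etransitivity; [exact (EF (sig (a := arrows X) u))|]. rewrite amap_sig.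
    rewrite <- (EF u). reflexivity. }
  exists (exist _ F HF). exact EF.
Qed.

Definition sfib (X Y : AGpd) (p : AHom X Y) : Prop :=
  forall x v, src x = x -> src v = p x -> exists u, src u = x /\ p u = v.

Lemma projective_fibE (X Y : Ob GpdG) (F : Hom GpdG X Y) :
  projective_fib F <-> sfib (arrow_map F).
Proof.
  split.
  - intros H x [c d v] Hx Hv. rewrite <- Hx in Hv |- *. clear Hx.
    destruct x as [a b0 x0]; simpl in Hv |- *; clear b0 x0.
    assert (Ec : c = GHom_fun F a) by exact (f_equal adom Hv). subst c.
    destruct (H _ _ v) as (x' & g & e & E).
    exists (mkArr g). split; [reflexivity|].
    apply (mkArr_eq_cast (ea := eq_refl) (eb := e)). simpl. now rewrite gcomp_id_r.
  - intros H x y f.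
    destruct (H (mkArr (gid x)) (mkArr f) eq_refl) as ([a b g] & Hs & Hm).
    { simpl. now rewrite fmap_id. }
    assert (a = x) by exact (f_equal adom Hs). subst a.
    assert (e : GHom_fun F b = y) by exact (f_equal acod Hm).
    exists b, g, e.
    pose proof (Arr_eq_cast (u := mkArr (fmap (GHom_fun F) g)) (v := mkArr f) eq_refl e Hm) as E.
    simpl in E. now rewrite gcomp_id_r in E.
Qed.

Lemma sig_eq (A : Type) (P : A -> Prop) (u v : {x | P x}) : proj1_sig u = proj1_sig v -> u = v.
Proof. destruct u, v; simpl. intros ->. f_equal. apply proof_irrelevance. Qed.

(** * Essential surjectivity: from arrow presentations back to groupoids with involution *)

Section Realize.
Variable S : AGpd.

Definition realize_gpd : Groupoid.
Proof.
  refine {| gob := {u : S | src u = u};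
    ghom := fun a b => {u : S | src u = proj1_sig a /\ tgt u = proj1_sig b};
    gid := fun a => exist _ (proj1_sig a) (conj (proj2_sig a) (tgt_obj (proj2_sig a)));
    gcomp := fun a b c g f => exist _ (cmp (proj1_sig f) (proj1_sig g)) _;
    ginv := fun a b f => exist _ (inv (proj1_sig f)) _ |}.
  Unshelve.
  - intros a b c d [h [h1 h2]] [g [g1 g2]] [f [f1 f2]]; apply sig_eq; simpl.
    apply cmp_assoc; congruence.
  - intros a b [f [f1 f2]]; apply sig_eq; simpl. rewrite <- f2. apply cmp_tgt.
  - intros a b [f [f1 f2]]; apply sig_eq; simpl. rewrite <- f1. apply cmp_src.
  - intros a b [f [f1 f2]]; apply sig_eq; simpl. now rewrite cmp_inv_r.
  - intros a b [f [f1 f2]]; apply sig_eq; simpl. now rewrite cmp_inv_l.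
  - destruct f as [f [f1 f2]], g as [g [g1 g2]]; simpl.
    split; [rewrite src_cmp | rewrite tgt_cmp]; congruence.
  - destruct f as [f [f1 f2]]; simpl. split; agpd; assumption.
Defined.

Lemma realize_inv_hom (a b : realize_gpd) (f : ghom a b) :
  src (sig (proj1_sig f)) = sig (proj1_sig a) /\ tgt (sig (proj1_sig f)) = sig (proj1_sig b).
Proof. destruct f as [f [f1 f2]]; simpl. agpd. split; congruence. Qed.

Definition realize_inv : Functor realize_gpd realize_gpd.
Proof.
  refine {| fobj := fun a : realize_gpd =>
      (exist _ (sig (proj1_sig a)) (sig_obj (proj2_sig a)) : realize_gpd);
    fmap := fun a b f => exist _ (sig (proj1_sig f)) (realize_inv_hom f) |}.
  - intros a; apply sig_eq; reflexivity.
  - intros a b c [g [g1 g2]] [f [f1 f2]]; apply sig_eq; simpl. apply sig_cmp; congruence.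
Defined.

Lemma realize_arr_eq (u v : Arr realize_gpd) :
  proj1_sig (ahom u) = proj1_sig (ahom v) -> u = v.
Proof.
  destruct u as [a b [f [f1 f2]]], v as [c d [g [g1 g2]]]; simpl.
  intros <-.
  assert (a = c) by (apply sig_eq; congruence). assert (b = d) by (apply sig_eq; congruence).
  subst. do 2 f_equal. apply proof_irrelevance.
Qed.

Definition realize : GpdInv.
Proof.
  refine {| gi_gpd := realize_gpd; gi_inv := realize_inv |}.
  apply feqE. intros u. apply realize_arr_eq. apply sig_sig.
Defined.

Definition realize_to : AHom (arrows realize) S.
Proof.
  refine {| amap := fun u : arrows realize => proj1_sig (ahom (u : Arr realize_gpd)) |}.
  - intros [a b [f [f1 f2]]]; simpl. congruence.
  - intros [a b [f [f1 f2]]]; simpl. congruence.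
  - intros [a b f] [c d g] E; apply (@mkArr_gid_inj realize_gpd) in E; simpl in E.
    subst; simpl. now rewrite acompE.
  - reflexivity.
Defined.

Definition realize_of : AHom S (arrows realize).
Proof.
  set (m := fun v : S =>
    mkArr (G := realize_gpd) (adom := exist _ (src v) (src_src v))
      (acod := exist _ (tgt v) (src_tgt v)) (exist _ v (conj eq_refl eq_refl))).
  refine {| amap := (m : S -> arrows realize) |};
    try (intros; apply realize_arr_eq; reflexivity).
  intros u v E. apply realize_arr_eq.
  refine (eq_sym (amap_cmp realize_to (u := m u) (v := m v) _)).
  apply realize_arr_eq. exact E.
Defined.

Lemma realize_toK u : realize_of (realize_to u) = u.
Proof. now apply realize_arr_eq. Qed.

Lemma realize_ofK v : realize_to (realize_of v) = v.
Proof. reflexivity. Qed.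
End Realize.

(** * Groupoids carved out by a predicate *)

(** The laws are asked on [ok] elements alone because on raw data they can fail: in the dependent
    product, the unit laws rest on the heap condition. Equations are then proved between raw values,
    free of membership proofs. *)
Record PreAGpd := {
  par :> Type;
  ok : par -> Prop;
  psrc : par -> par;
  ptgt : par -> par;
  pcmp : par -> par -> par;
  pinv : par -> par;
  psig : par -> par;
  ok_src : forall u, ok u -> ok (psrc u);
  ok_tgt : forall u, ok u -> ok (ptgt u);
  ok_cmp : forall u v, ok u -> ok v -> ptgt u = psrc v -> ok (pcmp u v);
  ok_inv : forall u, ok u -> ok (pinv u);
  ok_sig : forall u, ok u -> ok (psig u);
  psrc_src : forall u, ok u -> psrc (psrc u) = psrc u;
  ptgt_src : forall u, ok u -> ptgt (psrc u) = psrc u;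
  psrc_tgt : forall u, ok u -> psrc (ptgt u) = ptgt u;
  ptgt_tgt : forall u, ok u -> ptgt (ptgt u) = ptgt u;
  psrc_cmp : forall u v, ok u -> ok v -> ptgt u = psrc v -> psrc (pcmp u v) = psrc u;
  ptgt_cmp : forall u v, ok u -> ok v -> ptgt u = psrc v -> ptgt (pcmp u v) = ptgt v;
  pcmp_assoc : forall u v w, ok u -> ok v -> ok w -> ptgt u = psrc v -> ptgt v = psrc w ->
    pcmp (pcmp u v) w = pcmp u (pcmp v w);
  pcmp_src : forall u, ok u -> pcmp (psrc u) u = u;
  pcmp_tgt : forall u, ok u -> pcmp u (ptgt u) = u;
  psrc_inv : forall u, ok u -> psrc (pinv u) = ptgt u;
  ptgt_inv : forall u, ok u -> ptgt (pinv u) = psrc u;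
  pcmp_inv_r : forall u, ok u -> pcmp u (pinv u) = psrc u;
  pcmp_inv_l : forall u, ok u -> pcmp (pinv u) u = ptgt u;
  psig_sig : forall u, ok u -> psig (psig u) = u;
  psig_src : forall u, ok u -> psig (psrc u) = psrc (psig u);
  psig_tgt : forall u, ok u -> psig (ptgt u) = ptgt (psig u);
  psig_cmp : forall u v, ok u -> ok v -> ptgt u = psrc v ->
    psig (pcmp u v) = pcmp (psig u) (psig v) }.

Arguments ok {_} _.
Arguments psrc {_} _.
Arguments ptgt {_} _.
Arguments pcmp {_} _ _.
Arguments pinv {_} _.
Arguments psig {_} _.

Section Restrict.
Variable U : PreAGpd.
Notation V := {u : U | ok u}.

Definition restrict_cmp (u v : V) : V :=
  match excluded_middle_informative (ptgt (proj1_sig u) = psrc (proj1_sig v)) with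
  | left e => exist _ _ (ok_cmp (proj2_sig u) (proj2_sig v) e)
  | right _ => u
  end.

Lemma restrict_cmpE (u v : V) : ptgt (proj1_sig u) = psrc (proj1_sig v) ->
  proj1_sig (restrict_cmp u v) = pcmp (proj1_sig u) (proj1_sig v).
Proof.
  unfold restrict_cmp. now destruct excluded_middle_informative.
Qed.

Definition restrict : AGpd.
Proof.
  refine {| ar := V;
    src := fun u => exist _ _ (ok_src (proj2_sig u));
    tgt := fun u => exist _ _ (ok_tgt (proj2_sig u));
    cmp := restrict_cmp;
    inv := fun u => exist _ _ (ok_inv (proj2_sig u));
    sig := fun u => exist _ _ (ok_sig (proj2_sig u)) |};
  intros; repeat match goal with
  | H : @eq {_ : _ | _} _ _ |- _ => apply (f_equal (@proj1_sig _ _)) in H; simpl in H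
  | H : {_ : _ | _} |- _ => destruct H
  end; simpl in *; apply sig_eq; simpl; rewrite ?restrict_cmpE; simpl.
  all: rewrite ?restrict_cmpE; simpl.
  all: auto using psrc_src, ptgt_src, psrc_tgt, ptgt_tgt, psrc_cmp, ptgt_cmp, pcmp_assoc,
    pcmp_src, pcmp_tgt, psrc_inv, ptgt_inv, pcmp_inv_r, pcmp_inv_l, psig_sig, psig_src,
    psig_tgt, psig_cmp.
  all: rewrite ?ptgt_cmp, ?psrc_cmp, ?ptgt_src, ?psrc_tgt, ?psrc_inv, ?ptgt_inv,
     <- ?psig_src, <- ?psig_tgt by auto; congruence.
Defined.

Definition restrict_val (u : restrict) : U := proj1_sig u.

Lemma restrict_val_inj u v : restrict_val u = restrict_val v -> u = v.
Proof. apply sig_eq. Qed.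

Lemma restrict_val_cmp (u v : restrict) : tgt u = src v ->
  restrict_val (cmp u v) = pcmp (restrict_val u) (restrict_val v).
Proof.
  intros E. apply (f_equal restrict_val) in E. exact (restrict_cmpE E).
Qed.

Definition restrict_mk (u : U) (H : ok u) : restrict := exist _ u H.

Definition into_restrict (X : AGpd) (m : X -> U) (Hok : forall u, ok (m u))
    (Hs : forall u, m (src u) = psrc (m u)) (Ht : forall u, m (tgt u) = ptgt (m u))
    (Hc : forall u v, tgt u = src v -> m (cmp u v) = pcmp (m u) (m v))
    (Hg : forall u, m (sig u) = psig (m u)) : AHom X restrict.
Proof.
  refine {| amap := fun u => restrict_mk (Hok u) |}; intros; apply restrict_val_inj; simpl; auto.
  rewrite restrict_val_cmp; simpl; auto.
  apply restrict_val_inj; simpl. now rewrite <- Hs, <- Ht, H.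
Defined.

Definition from_restrict (X : AGpd) (m : U -> X)
    (Hs : forall u, ok u -> m (psrc u) = src (m u)) (Ht : forall u, ok u -> m (ptgt u) = tgt (m u))
    (Hc : forall u v, ok u -> ok v -> ptgt u = psrc v -> m (pcmp u v) = cmp (m u) (m v))
    (Hg : forall u, ok u -> m (psig u) = sig (m u)) : AHom restrict X.
Proof.
  refine {| amap := fun u => m (restrict_val u) |}.
  - intros [u Hu]; apply Hs, Hu.
  - intros [u Hu]; apply Ht, Hu.
  - intros [u Hu] [v Hv] E. rewrite restrict_val_cmp by exact E. apply Hc; auto.
    exact (f_equal restrict_val E).
  - intros [u Hu]; apply Hg, Hu.
Defined.
End Restrict.

(** * Products, indiscrete groupoids and subgroupoids *)

Ltac split_pairs := repeat match goal with
  | H : (_ * _)%type |- _ => destruct H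
  | |- forall _ : (_ * _)%type, _ => intros [? ?]
  | H : (_, _) = (_, _) |- _ => injection H; clear H; intros
  end.

Definition prod_agpd (X Y : AGpd) : AGpd.
Proof.
  refine {| ar := X * Y;
    src := fun u => (src (fst u), src (snd u));
    tgt := fun u => (tgt (fst u), tgt (snd u));
    cmp := fun u v => (cmp (fst u) (fst v), cmp (snd u) (snd v));
    inv := fun u => (inv (fst u), inv (snd u));
    sig := fun u => (sig (fst u), sig (snd u)) |};
  simpl; intros; split_pairs; simpl in *; f_equal;
  auto using src_cmp, tgt_cmp, cmp_assoc; agpd; auto.
Defined.

(** In a product with this groupoid, an arrow is an arrow of the other factor with arbitrary labels
    at its ends; [fac] uses this to replicate the objects of [X]. *)
Definition chaotic (O : Type) (s : O -> O) (ss : forall o, s (s o) = o) : AGpd.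
Proof.
  refine {| ar := O * O;
    src := fun u => (fst u, fst u);
    tgt := fun u => (snd u, snd u);
    cmp := fun u v => (fst u, snd v);
    inv := fun u => (snd u, fst u);
    sig := fun u => (s (fst u), s (snd u)) |};
  simpl; intros; split_pairs; simpl in *; congruence.
Defined.

Definition sub_agpd (X : AGpd) (P : X -> Prop)
    (Ps : forall u, P u -> P (src u)) (Pt : forall u, P u -> P (tgt u))
    (Pc : forall u v, P u -> P v -> tgt u = src v -> P (cmp u v))
    (Pi : forall u, P u -> P (inv u)) (Pg : forall u, P u -> P (sig u)) : PreAGpd.
Proof.
  refine {| ok := P; psrc := @src X; ptgt := @tgt X; pcmp := @cmp X; pinv := @inv X;
    psig := @sig X |}; auto; intros; agpd; auto using cmp_assoc.
Defined.

(** * Pullbacks *)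

Section Pullback.
Variables A B D : AGpd.
Variables (f : AHom A D) (g : AHom B D).

Definition apullback (P : AGpd) (pa : AHom P A) (pb : AHom P B) : Prop :=
  (forall w, f (pa w) = g (pb w)) /\
  (forall w w', pa w = pa w' -> pb w = pb w' -> w = w') /\
  (forall a b, f a = g b -> exists w, pa w = a /\ pb w = b).

Definition pb_agpd : PreAGpd.
Proof.
  refine (@sub_agpd (prod_agpd A B) (fun u => f (fst u) = g (snd u)) _ _ _ _ _);
  simpl; intros; split_pairs; simpl in *.
  all: rewrite ?amap_src, ?amap_tgt, ?amap_inv, ?amap_sig, ?amap_cmp by auto; congruence.
Defined.

Definition pb_fst : AHom (restrict pb_agpd) A.
Proof. now refine (@from_restrict pb_agpd A (fun u => fst u) _ _ _ _). Defined.

Definition pb_snd : AHom (restrict pb_agpd) B.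
Proof. now refine (@from_restrict pb_agpd B (fun u => snd u) _ _ _ _). Defined.

Lemma pb_apullback : apullback pb_fst pb_snd.
Proof.
  split; [|split].
  - intros [[a b] H]; exact H.
  - intros [[a b] H] [[a' b'] H']; simpl; intros -> ->. now apply sig_eq.
  - intros a b H. now exists (@restrict_mk pb_agpd (a, b) H).
Qed.

(** Preimages are chosen arrow by arrow; joint injectivity makes the choice unique, hence functorial
    and equivariant. *)
Lemma apullback_pair (P : AGpd) (pa : AHom P A) (pb : AHom P B) :
  apullback pa pb ->
  forall (W : AGpd) (u : AHom W A) (v : AHom W B), (forall w, f (u w) = g (v w)) ->
  exists k : AHom W P, (forall w, pa (k w) = u w) /\ (forall w, pb (k w) = v w).
Proof.
  intros (Hc & Hi & He) W u v E.
  destruct (choice (fun w p => pa p = u w /\ pb p = v w) (fun w => He _ _ (E w))) as [k Hk].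
  assert (Hk1 : forall w, pa (k w) = u w) by apply Hk.
  assert (Hk2 : forall w, pb (k w) = v w) by apply Hk.
  unshelve eexists {| amap := k |}; [..|exact (conj Hk1 Hk2)].
  all: intros; apply Hi.
  all: rewrite ?amap_src, ?amap_tgt, ?amap_sig, ?Hk1, ?Hk2, ?amap_src, ?amap_tgt, ?amap_sig; auto.
  all: assert (tgt (k u0) = src (k v0)) by
    (apply Hi; rewrite !amap_src, !amap_tgt, ?Hk1, ?Hk2, <- !amap_src, <- !amap_tgt; congruence).
  all: rewrite !amap_cmp, ?Hk1, ?Hk2 by assumption; reflexivity.
Qed.
End Pullback.

Lemma apullback_fib (A B D P : AGpd) (f : AHom A D) (g : AHom B D) (pa : AHom P A) (pb : AHom P B) :
  sfib g -> apullback f g pa pb -> sfib pa.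
Proof.
  intros Hg (Hc & Hi & He) x v Hx Hv.
  destruct (Hg (pb x) (f v)) as (e & E1 & E2).
  { now apply amap_obj. }
  { rewrite <- amap_src, Hv. apply Hc. }
  destruct (He v e) as (w & W1 & W2); [congruence|].
  exists w. split; [|exact W1].
  apply Hi; rewrite amap_src; congruence.
Qed.

Lemma iso_sfib (X Y : AGpd) (f : AHom X Y) (g : Y -> X) :
  (forall x, g (f x) = x) -> (forall y, f (g y) = y) -> sfib f.
Proof.
  intros H1 H2 x v Hx Hv. exists (g v). split; [|apply H2].
  rewrite <- (H1 (src (g v))), amap_src, H2, Hv. apply H1.
Qed.

(** * Acyclic cofibrations *)

(** Objects being identities, injectivity on arrows amounts to faithfulness together with
    injectivity on objects. The second clause is fullness. *)
Definition acof (A B : AGpd) (i : AHom A B) : Prop :=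
  (forall u v, i u = i v -> u = v) /\
  (forall w a a', src w = i a -> tgt w = i a' -> exists u, i u = w) /\
  (forall b, src b = b -> (exists a, i a = b) \/
     (sig b <> b /\ exists a k, src k = i a /\ tgt k = b)).

(** Within an orbit of two elements the choice at one determines the other. At a fixed point the
    chosen value has to be fixed too, which is what the last hypothesis grants. *)
Lemma equivariant_choice (B T : Type) (s : B -> B) (t : T -> T) (R : B -> T -> Prop) :
  (forall b, s (s b) = b) -> (forall x, t (t x) = x) ->
  (forall b, exists x, R b x) -> (forall b x, R b x -> R (s b) (t x)) ->
  (forall b x, s b = b -> R b x -> t x = x) ->
  exists c : B -> T, (forall b, R b (c b)) /\ (forall b, c (s b) = t (c b)).
Proof.
  intros ss tt HR Hs Hf. destruct (choice R HR) as [c Hc].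
  set (rep := fun b => epsilon (inhabits b) (fun x => x = b \/ x = s b)).
  assert (Hrep : forall b, rep b = b \/ rep b = s b).
  { intros b. apply (epsilon_spec (inhabits b) (fun x => x = b \/ x = s b)). eauto. }
  assert (Hrs : forall b, rep (s b) = rep b).
  { intros b. unfold rep.
    (* The orbits of [b] and [s b] are the same predicate by extensionality, so [epsilon] picks the
       same element although the inhabitants supplied differ. *)
    replace (fun x => x = s b \/ x = s (s b)) with (fun x => x = b \/ x = s b).
    - apply epsilon_inh_irrelevance. eauto.
    - apply functional_extensionality; intros x; apply propositional_extensionality.
      rewrite ss. tauto. }
  set (d := fun b => if excluded_middle_informative (rep b = b) then c b else t (c (s b))).
  exists d. split; intros b; unfold d; rewrite ?Hrs, ?ss;
    repeat destruct excluded_middle_informative; auto.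
  - rewrite <- (ss b) at 1. auto.
  - assert (s b = b) by congruence. rewrite H. symmetry. eauto.
  - exfalso. destruct (Hrep b); congruence.
Qed.

(** * Lifting against isofibrations *)

Lemma src_cmp3 (X : AGpd) (k w l : X) : tgt k = src w -> tgt w = tgt l ->
  src (cmp k (cmp w (inv l))) = src k.
Proof. intros; agpd; congruence. Qed.

Lemma tgt_cmp3 (X : AGpd) (k w l : X) : tgt k = src w -> tgt w = tgt l ->
  tgt (cmp k (cmp w (inv l))) = src l.
Proof. intros; agpd; congruence. Qed.

(** Conjugation by isomorphisms chosen at the objects is functorial: the inner [l] telescopes. Both
    the diagonal in [acof_lift] and the map [fac_out] have this shape. *)
Lemma cmp3_cmp (X : AGpd) (k w l w' m : X) :
  tgt k = src w -> tgt w = tgt l -> tgt w = src w' -> tgt w' = tgt m ->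
  cmp k (cmp (cmp w w') (inv m)) = cmp (cmp k (cmp w (inv l))) (cmp l (cmp w' (inv m))).
Proof.
  intros. rewrite (cmp_assoc (u := k)) by gside. rewrite (cmp_assoc (u := w)) by gside.
  rewrite (cmp_assoc (u := w) (v := inv l)) by gside.
  rewrite cmp_VK by gside. reflexivity.
Qed.

Lemma cmp3_K (X : AGpd) (k w l : X) : tgt k = src w -> tgt w = tgt l ->
  cmp (inv k) (cmp (cmp k (cmp w (inv l))) l) = w.
Proof.
  intros. rewrite cmp_assoc by gside. rewrite cmp_VK by gside.
  rewrite cmp_assoc by gside. rewrite cmp_inv_l. rewrite <- H0. apply cmp_tgt.
Qed.

Lemma acof_lift (A B E F : AGpd) (i : AHom A B) (p : AHom E F) (u : AHom A E) (v : AHom B F) :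
  acof i -> sfib p -> (forall a, p (u a) = v (i a)) ->
  exists h : AHom B E, (forall a, h (i a) = u a) /\ (forall b, p (h b) = v b).
Proof.
  intros (Hi & Hfull & Hob) Hp Huv.
  (* A datum at [b] concerns the object [src b]: an object [a], an arrow [k] from [i a] to [src b],
     and a lift [e] of [v k] starting at [u a]. The last clause forces the trivial datum on the
     image, so that the diagonal extends [u]. *)
  pose (R := fun (b : B) (x : A * B * E) => let '(a, k, e) := x in
    src a = a /\ src k = i a /\ tgt k = src b /\ src e = u a /\ p e = v k /\
    (forall a0, i a0 = src b -> a = a0 /\ k = src b /\ e = u a0)).
  destruct (@equivariant_choice B (A * B * E) (@sig B)
    (fun x => let '(a, k, e) := x in (sig a, sig k, sig e)) R) as (c & Hc & Hcs).
  - apply sig_sig.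
  - intros [[a k] e]. now rewrite !sig_sig.
  - intros b. destruct (classic (exists a, i a = src b)) as [[a Ha]|Hn].
    + assert (src a = a) by (apply Hi; rewrite amap_src, Ha; agpd; congruence).
      exists (a, src b, u a). repeat split; agpd; try congruence.
      * apply Hi; congruence.
      * f_equal. apply Hi; congruence.
    + destruct (Hob (src b)) as [H|(_ & a & k & H1 & H2)]; [apply src_src|tauto|].
      assert (src a = a) by (apply Hi; rewrite amap_src, <- H1; apply src_src).
      destruct (Hp (u a) (v k)) as (e & E1 & E2).
      { now apply amap_obj. }
      { rewrite <- amap_src, H1. auto. }
      exists (a, k, e). repeat split; auto; exfalso; eauto.
  - intros b [[a k] e] (H1 & H2 & H3 & H4 & H5 & H6); repeat split; agpd; try congruence.
    all: try (destruct (H6 (sig a0)) as (G1 & G2 & G3);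
      [rewrite amap_sig, H; agpd; congruence|]).
    all: rewrite ?G1, ?G2, ?G3; agpd; congruence.
  (* A fixed [b] has a fixed source, which freeness puts in the image; there the datum is the forced
     one, and injectivity of [i] makes it fixed. *)
  - intros b [[a k] e] Hb (H1 & H2 & H3 & H4 & H5 & H6).
    assert (Hsb : sig (src b) = src b) by now rewrite sig_src, Hb.
    destruct (Hob (src b) (src_src b)) as [[a0 H]|[H _]]; [|contradiction].
    destruct (H6 _ H) as (-> & -> & ->).
    assert (sig a0 = a0) by (apply Hi; now rewrite amap_sig, H).
    now rewrite Hsb, <- amap_sig, H0.
  - set (ca := fun b => fst (fst (c b))). set (ck := fun b => snd (fst (c b))).
    set (ce := fun b => snd (c b)).
    assert (HR : forall b, R b (ca b, ck b, ce b)).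
    { intros b. generalize (Hc b). unfold ca, ck, ce. now destruct (c b) as [[? ?] ?]. }
    clear Hc.
    assert (Sa : forall b, ca (sig b) = sig (ca b)).
    { intros b. unfold ca. rewrite Hcs. now destruct (c b) as [[? ?] ?]. }
    assert (Sk : forall b, ck (sig b) = sig (ck b)).
    { intros b. unfold ck. rewrite Hcs. now destruct (c b) as [[? ?] ?]. }
    assert (Se : forall b, ce (sig b) = sig (ce b)).
    { intros b. unfold ce. rewrite Hcs. now destruct (c b) as [[? ?] ?]. }
    clearbody ca ck ce. clear c Hcs.
    assert (R1 : forall b, src (ca b) = ca b) by apply HR.
    assert (R2 : forall b, src (ck b) = i (ca b)) by apply HR.
    assert (R3 : forall b, tgt (ck b) = src b) by apply HR.
    assert (R4 : forall b, src (ce b) = u (ca b)) by apply HR.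
    assert (R5 : forall b, p (ce b) = v (ck b)) by apply HR.
    assert (R6 : forall b a, i a = src b -> ca b = a /\ ck b = src b /\ ce b = u a) by apply HR.
    clear HR R.
    assert (K1 : forall b, tgt (ck (src b)) = src b) by (intros; rewrite R3; agpd; auto).
    assert (K2 : forall b, tgt b = tgt (ck (tgt b))) by (intros; rewrite R3; agpd; auto).
    (* Moving [b] along the chosen arrows brings its ends into the image, where fullness applies;
       [G] is thus a retraction of [B] onto [A]. *)
    destruct (choice (fun b a => i a = cmp (ck (src b)) (cmp b (inv (ck (tgt b)))))) as [G HG].
    { intros b. apply (Hfull _ (ca (src b)) (ca (tgt b))).
      - rewrite src_cmp3; auto.
      - rewrite tgt_cmp3; auto. }
    assert (Gs : forall b, src (G b) = ca (src b)).
    { intros b. apply Hi. rewrite amap_src, HG, src_cmp3; auto. }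
    assert (Gt : forall b, tgt (G b) = ca (tgt b)).
    { intros b. apply Hi. rewrite amap_tgt, HG, tgt_cmp3; auto. }
    assert (GS : forall b, G (sig b) = sig (G b)).
    { intros b. apply Hi. rewrite amap_sig, !HG.
      rewrite <- sig_src, <- sig_tgt, !Sk, <- sig_inv.
      rewrite <- !sig_cmp; auto; agpd; rewrite ?R3; agpd; congruence. }
    assert (Go : forall b, src b = b -> G b = ca b).
    { intros b Hb. apply Hi. rewrite HG, (tgt_obj Hb), Hb.
      rewrite (@cmp_obj_l _ b) by (rewrite ?src_inv, ?R3; auto).
      now rewrite cmp_inv_r. }
    assert (Gc : forall b b', tgt b = src b' -> G (cmp b b') = cmp (G b) (G b')).
    { intros b b' Hb. apply Hi. rewrite amap_cmp, !HG by congruence.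
      rewrite src_cmp, tgt_cmp, <- Hb by auto. apply cmp3_cmp; congruence. }
    assert (U1 : forall b, tgt (inv (ce (src b))) = src (u (G b))).
    { intros b. rewrite tgt_inv, R4, <- amap_src. congruence. }
    assert (U2 : forall b, tgt (u (G b)) = src (ce (tgt b))).
    { intros b. rewrite R4, <- amap_tgt. congruence. }
    (* The map [p] sends [u (G b)] to [v] of a conjugate of [b]; since [ce] lifts [v (ck _)],
       conjugating back by [ce] corrects this. *)
    set (h := fun b => cmp (inv (ce (src b))) (cmp (u (G b)) (ce (tgt b)))).
    assert (Hs : forall b, src (h b) = tgt (ce (src b))).
    { intros b. unfold h. rewrite src_cmp; [apply src_inv|]. rewrite src_cmp; auto. }
    assert (Ht : forall b, tgt (h b) = tgt (ce (tgt b))).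
    { intros b. unfold h. rewrite !tgt_cmp; auto. rewrite src_cmp; auto. }
    assert (Ho : forall b, src b = b -> h b = tgt (ce b)).
    { intros b Hb. unfold h. rewrite (tgt_obj Hb), Hb, (Go _ Hb), <- R4, cmp_src.
      apply cmp_inv_l. }
    unshelve eexists {| amap := h |}.
    + intros b. rewrite Hs. now apply Ho, src_src.
    + intros b. rewrite Ht. now apply Ho, src_tgt.
    + intros b b' Hb. unfold h. rewrite src_cmp, tgt_cmp, Gc, <- Hb by auto.
      rewrite amap_cmp by congruence.
      pose proof (U1 b). pose proof (U2 b). pose proof (U1 b'). pose proof (U2 b').
      rewrite <- Hb in *.
      (* The double inverses bring the goal to the shape of [cmp3_cmp]. *)
      replace (ce (tgt b')) with (inv (inv (ce (tgt b')))) by apply inv_inv.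
      replace (ce (tgt b)) with (inv (inv (ce (tgt b)))) at 1 by apply inv_inv.
      apply cmp3_cmp; agpd; congruence.
    + intros b. unfold h. rewrite <- sig_src, <- sig_tgt, GS, !Se, <- sig_inv, amap_sig.
      rewrite !sig_cmp; auto. rewrite src_cmp; auto.
    + split.
      * intros a; simpl; unfold h.
        destruct (R6 (src (i a)) (src a)) as (_ & _ & ->). { rewrite amap_src; agpd; auto. }
        destruct (R6 (tgt (i a)) (tgt a)) as (_ & _ & ->). { rewrite amap_tgt; agpd; auto. }
        assert (G (i a) = a) as ->.
        { apply Hi. rewrite HG.
          destruct (R6 (src (i a)) (src a)) as (_ & -> & _). { rewrite amap_src; agpd; auto. }
          destruct (R6 (tgt (i a)) (tgt a)) as (_ & -> & _). { rewrite amap_tgt; agpd; auto. }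
          rewrite (inv_obj (u := src (tgt (i a)))) by apply src_src.
          rewrite src_src, src_tgt, cmp_tgt. apply cmp_src. }
        rewrite !amap_tgt, cmp_tgt, inv_obj; agpd; auto.
        rewrite amap_src. apply cmp_src.
      * intros b; simpl; unfold h.
        rewrite !amap_cmp; auto. 2: rewrite src_cmp; auto.
        rewrite amap_inv, !R5, Huv, HG, <- amap_inv.
        rewrite <- (amap_cmp v), <- (amap_cmp v).
        -- f_equal. apply cmp3_K; auto.
        -- rewrite src_cmp, src_cmp3, tgt_inv; auto. rewrite tgt_cmp3; auto.
        -- rewrite tgt_cmp3; auto.
Qed.

Lemma acof_pullback (A B D Z Y X : AGpd) (p : AHom B D) (q : AHom A D) (i : AHom A B)
    (z : AHom Z D) (y1 : AHom Y Z) (y2 : AHom Y B) (x1 : AHom X Y) (x2 : AHom X A) :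
  sfib q -> (forall a, p (i a) = q a) -> acof i ->
  apullback z p y1 y2 -> apullback y2 i x1 x2 -> acof x1.
Proof.
  intros Hq Hpi (Hi & Hf & Ho) (Yc & Yi & Ye) (Xc & Xi & Xe).
  split; [|split].
  - intros w w' E. apply Xi; auto. apply Hi. rewrite <- !Xc. congruence.
  - intros w a a' Hs Ht.
    destruct (Hf (y2 w) (x2 a) (x2 a')) as [g Hg].
    { now rewrite <- amap_src, Hs. }
    { now rewrite <- amap_tgt, Ht. }
    destruct (Xe w g) as (k & K & _); eauto.
  - intros y Hy. destruct (Ho (y2 y)) as [[a Ha]|(Hn & a & k & H1 & H2)].
    { now apply amap_obj. }
    + left. destruct (Xe y a) as (w & W & _); eauto.
    + right. split. { intros E. apply Hn. now rewrite <- amap_sig, E. }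
      assert (src a = a) by (apply Hi; rewrite amap_src, <- H1; apply src_src).
      (* The arrow [k] need not lie over an identity of [D], so it cannot be paired with the
         identity [y1 y]. Lifting [p k] to [e] in [A] replaces it by [(i e)^-1 k], which starts at
         the image of [tgt e] and lies over an identity. *)
      destruct (Hq a (p k)) as (e & E1 & E2); auto.
      { rewrite <- amap_src, H1. apply Hpi. }
      assert (M : tgt (inv (i e)) = src k) by (agpd; congruence).
      destruct (Ye (y1 y) (cmp (inv (i e)) k)) as (w & W1 & W2).
      { rewrite amap_cmp, amap_inv, Hpi, E2, cmp_inv_l by auto.
        rewrite <- amap_tgt, H2. apply Yc. }
      assert (Hy1 : src (y1 y) = y1 y) by now apply amap_obj.
      destruct (Xe (src w) (tgt e)) as (x & X1 & X2).
      { rewrite amap_src, W2, src_cmp, src_inv, amap_tgt; auto. }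
      exists x, w. split; [auto|].
      apply Yi; rewrite amap_tgt, ?W1, ?W2.
      * now apply tgt_obj.
      * now rewrite tgt_cmp.
Qed.

(** * Factorization *)

Section Factorization.
Variables (X Y : AGpd) (f : AHom X Y).

(* An object [(x, a, s)] of the factorization consists of an object [x] of [X]
   and an arrow [a] of [Y] out of [f x]; [s = None] marks the image of [X], where
   [a] is an identity, and the two signs [Some _], exchanged by the involution,
   make the added objects free. *)
Definition fac_ob : Type := X * Y * option bool.

Definition fac_ob_sig (o : fac_ob) : fac_ob :=
  let '(x, a, s) := o in (sig x, sig a, option_map negb s).

Lemma fac_ob_sig_sig o : fac_ob_sig (fac_ob_sig o) = o.
Proof. destruct o as [[x a] [[]|]]; simpl; now rewrite !sig_sig. Qed.

Definition base (o : fac_ob) : X := fst (fst o).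
Definition label (o : fac_ob) : Y := snd (fst o).

Definition fac_ob_ok (o : fac_ob) : Prop :=
  src (base o) = base o /\ src (label o) = f (base o) /\ (snd o = None -> label o = f (base o)).

Lemma fac_ob_ok_sig o : fac_ob_ok o -> fac_ob_ok (fac_ob_sig o).
Proof.
  destruct o as [[x a] s]; unfold fac_ob_ok, base, label; simpl. intros (H1 & H2 & H3).
  rewrite <- !sig_src, H1, H2, amap_sig. repeat split.
  destruct s; [discriminate|]. intros _. now rewrite H3.
Qed.

(** Arrows are those of [X] between the bases; labels and signs do not restrict them. This makes
    [fac_in] fully faithful, while the labels serve to define [fac_out] by conjugation. *)
Definition fac : PreAGpd.
Proof.
  refine (@sub_agpd (prod_agpd (chaotic fac_ob_sig_sig) X) (fun u =>
    fac_ob_ok (fst (fst u)) /\ fac_ob_ok (snd (fst u)) /\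
    src (snd u) = base (fst (fst u)) /\ tgt (snd u) = base (snd (fst u))) _ _ _ _ _);
  simpl; intros [[o o'] u]; simpl.
  - intros (H1 & H2 & H3 & H4). rewrite src_src, tgt_src. auto.
  - intros (H1 & H2 & H3 & H4). rewrite src_tgt, tgt_tgt. auto.
  - intros [[o1 o1'] u1]; simpl. intros (H1 & H2 & H3 & H4) (H1' & H2' & H3' & H4') E.
    assert (E1 : tgt u = src u1) by exact (f_equal snd E). rewrite src_cmp, tgt_cmp by auto. auto.
  - intros (H1 & H2 & H3 & H4). agpd. auto.
  - intros (H1 & H2 & H3 & H4). rewrite <- sig_src, <- sig_tgt, H3, H4.
    repeat split; try apply fac_ob_ok_sig; auto; now destruct o as [[? ?] ?], o' as [[? ?] ?].
Defined.

Definition fac_val (w : restrict fac) : fac_ob * fac_ob * X := restrict_val w.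

Lemma fac_image_ok x : src x = x -> fac_ob_ok (x, f x, None).
Proof. intros H. repeat split; auto. now apply amap_obj. Qed.

(** The unsigned copy is unavoidable here: a fixed object of [X] must go to a fixed object, and no
    signed object is fixed. *)
Definition fac_in : AHom X (restrict fac).
Proof.
  refine (@into_restrict fac X
    (fun u => ((src u, f (src u), None), (tgt u, f (tgt u), None), u)) _ _ _ _ _);
  simpl; intros; agpd; auto.
  auto using fac_image_ok, src_src, src_tgt.
Defined.

Definition fac_out : AHom (restrict fac) Y.
Proof.
  refine (@from_restrict fac Y
    (fun u => cmp (inv (label (fst (fst u)))) (cmp (f (snd u)) (label (snd (fst u))))) _ _ _ _);
  simpl.
  - intros [[o o'] u] ((O1 & O2 & _) & (O1' & O2' & _) & H1 & H2); simpl in *.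
    rewrite H1, (cmp_obj_l (u := f (base o))), cmp_inv_l
      by (rewrite <- ?amap_src; congruence).
    rewrite src_cmp; agpd; congruence.
  - intros [[o o'] u] ((O1 & O2 & _) & (O1' & O2' & _) & H1 & H2); simpl in *.
    rewrite H2, (cmp_obj_l (u := f (base o'))), cmp_inv_l
      by (rewrite <- ?amap_src; congruence).
    rewrite !tgt_cmp; agpd; congruence.
  - intros [[o o'] u] [[o1 o1'] v] ((O1 & O2 & _) & (O1' & O2' & _) & H1 & H2)
      ((P1 & P2 & _) & (P1' & P2' & _) & H3 & H4) E; simpl in *.
    assert (E1 : tgt u = src v) by exact (f_equal snd E).
    assert (o' = o1) by exact (f_equal (fun w => fst (fst w)) E). subst o1.
    rewrite amap_cmp by auto.
    pose proof (@cmp3_cmp Y (inv (label o)) (f u) (inv (label o')) (f v) (inv (label o1')))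
      as C. rewrite !inv_inv in C. apply C; agpd; congruence.
  - intros [[[[x a] s] [[x' a'] s']] u] ((O1 & O2 & _) & (O1' & O2' & _) & H1 & H2).
    unfold label, base in *; simpl in *. rewrite !sig_cmp, sig_inv, amap_sig; agpd; congruence.
Defined.

Lemma fac_out_in u : fac_out (fac_in u) = f u.
Proof.
  simpl. unfold label; simpl. rewrite inv_obj by (apply amap_obj, src_src).
  now rewrite amap_src, amap_tgt, cmp_tgt, cmp_src.
Qed.

Lemma fac_out_fib : sfib fac_out.
Proof.
  intros [[[o o'] u] [H1 [H2 [H3 H4]]]] v Hx Hv. simpl in *.
  assert (Eu : src u = u) by exact (f_equal (fun w => snd (fac_val w)) Hx).
  assert (o = o') by exact (f_equal (fun w => snd (fst (fac_val w))) Hx). subst o'.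
  destruct H1 as (G1 & G2 & G3).
  assert (Hv' : src v = tgt (label o)).
  { rewrite Hv, <- Eu, H3, (cmp_obj_l (u := f (base o))), cmp_inv_l;
      rewrite <- ?amap_src; congruence. }
  (* The lift keeps the base and prolongs the label by [v]. The new label need not be an identity,
     so a sign is required; which one is arbitrary. *)
  set (o' := (base o, cmp (label o) v, Some true) : fac_ob).
  assert (Hs : src (cmp (label o) v) = f (base o)) by (rewrite src_cmp; auto).
  assert (Ho : fac_ob_ok o') by (repeat split; [assumption..|discriminate]).
  exists (@restrict_mk fac (o, o', base o)
    (conj (conj G1 (conj G2 G3)) (conj Ho (conj G1 (tgt_obj G1))))).
  split.
  - apply sig_eq; simpl. repeat f_equal; congruence.
  - simpl. unfold label at 2; simpl. rewrite (cmp_obj_l (u := f (base o))); auto using amap_obj.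
    apply cmp_VK. auto.
Qed.

Lemma fac_in_acof : acof fac_in.
Proof.
  split; [|split].
  - intros u v E. exact (f_equal (fun w => snd (fac_val w)) E).
  - intros [[[o o'] u] [H1 [H2 [H3 H4]]]] a a' Hs Ht. exists u. simpl in *.
    assert (Es : src u = a) by exact (f_equal (fun w => snd (fac_val w)) Hs).
    assert (Et : tgt u = a') by exact (f_equal (fun w => snd (fac_val w)) Ht).
    assert (Eo : o = (src a, f (src a), None))
      by exact (f_equal (fun w => fst (fst (fac_val w))) Hs).
    assert (Eo' : o' = (src a', f (src a'), None))
      by exact (f_equal (fun w => fst (fst (fac_val w))) Ht).
    apply sig_eq; simpl. rewrite Eo, Eo', <- Es, <- Et, src_src, src_tgt. reflexivity.
  - intros [[[o o'] u] [H1 [H2 [H3 H4]]]] Hx.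
    assert (Eu : src u = u) by exact (f_equal (fun w => snd (fac_val w)) Hx).
    assert (o = o') by exact (f_equal (fun w => snd (fst (fac_val w))) Hx). subst o'.
    destruct o as [[x a] [s|]]; unfold base in *; simpl in *.
    + right. split.
      * intros E. apply (f_equal (fun w => snd (fst (fst (fac_val w))))) in E.
        simpl in E. destruct s; discriminate.
      * exists x. destruct H1 as (G1 & G2 & G3). unfold base in *; simpl in *.
        exists (@restrict_mk fac ((x, f x, None), (x, a, Some s), x)
          (conj (fac_image_ok G1) (conj (conj G1 (conj G2 G3)) (conj G1 (tgt_obj G1))))).
        split; apply sig_eq; simpl; rewrite ?G1, ?(tgt_obj G1); repeat f_equal; congruence.
    + left. exists x. destruct H1 as (G1 & G2 & G3). unfold base, label in *; simpl in *.
      apply sig_eq; simpl. rewrite G1, (tgt_obj G1), G3 by reflexivity. repeat f_equal. congruence.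
Qed.

(** A retract argument: [h] and [fac_out] present [f] as a retract of [fac_in]. Freeness descends
    because [h] sends fixed objects to fixed objects. *)
Lemma acof_of_section (h : AHom Y (restrict fac)) :
  (forall x, h (f x) = fac_in x) -> (forall y, fac_out (h y) = y) -> acof f.
Proof.
  intros Hin Hout. destruct fac_in_acof as (Fi & Ff & Fo). split; [|split].
  - intros u v E. apply Fi. rewrite <- !Hin. congruence.
  - intros w a a' Hs Ht. destruct (Ff (h w) a a') as [u Hu].
    + rewrite <- amap_src, Hs; auto.
    + rewrite <- amap_tgt, Ht; auto.
    + exists u. rewrite <- (fac_out_in u), Hu. apply Hout.
  - intros b Hb. destruct (Fo (h b)) as [[a Ha]|(Hn & a & k & K1 & K2)].
    + now apply amap_obj.
    + left. exists a. now rewrite <- (fac_out_in a), Ha.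
    + right. split.
      * intros E. apply Hn. now rewrite <- amap_sig, E.
      * exists a, (fac_out k). rewrite <- amap_src, <- amap_tgt, K1, K2, fac_out_in. auto.
Qed.
End Factorization.

(** * Dependent products *)

Section SubsetCalculus.
Variable X : AGpd.
Implicit Types T U V : X -> Prop.

Definition smul T U : X -> Prop :=
  fun e => exists t u, T t /\ U u /\ tgt t = src u /\ e = cmp t u.
Definition sinv T : X -> Prop := fun e => T (inv e).
Definition ssig T : X -> Prop := fun e => T (sig e).

(** Equivalent to [T T^-1 T = T]: [T] is a bitorsor between [T T^-1] and [T^-1 T], which act as its
    source and target. *)
Definition heap T : Prop := forall t1 t2 t3, T t1 -> T t2 -> T t3 ->
  tgt t1 = tgt t2 -> src t2 = src t3 -> T (cmp t1 (cmp (inv t2) t3)).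

Lemma subset_ext T U : (forall e, T e -> U e) -> (forall e, U e -> T e) -> T = U.
Proof.
  intros H1 H2. apply functional_extensionality; intros e.
  apply propositional_extensionality; split; auto.
Qed.

Lemma smul_intro T U t u : T t -> U u -> tgt t = src u -> smul T U (cmp t u).
Proof. intros; exists t, u; auto. Qed.

Lemma smul_assoc T U V : smul (smul T U) V = smul T (smul U V).
Proof.
  apply subset_ext.
  - intros e (x & v & (t & u & Ht & Hu & E1 & ->) & Hv & E2 & ->).
    rewrite tgt_cmp in E2 by auto. rewrite cmp_assoc by auto.
    apply smul_intro; auto using smul_intro. rewrite src_cmp; auto.
  - intros e (t & x & Ht & (u & v & Hu & Hv & E2 & ->) & E1 & ->).
    rewrite src_cmp in E1 by auto. rewrite <- cmp_assoc by auto.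
    apply smul_intro; auto using smul_intro. rewrite tgt_cmp; auto.
Qed.

Lemma sinv_sinv T : sinv (sinv T) = T.
Proof. apply subset_ext; unfold sinv; intros e; now rewrite inv_inv. Qed.

Lemma ssig_ssig T : ssig (ssig T) = T.
Proof. apply subset_ext; unfold ssig; intros e; now rewrite sig_sig. Qed.

Lemma ssig_sinv T : ssig (sinv T) = sinv (ssig T).
Proof. apply subset_ext; unfold ssig, sinv; intros e; now rewrite sig_inv. Qed.

Lemma sinv_smul T U : sinv (smul T U) = smul (sinv U) (sinv T).
Proof.
  apply subset_ext.
  - intros e (t & u & Ht & Hu & E & E'). rewrite <- (inv_inv e), E', inv_cmp by auto.
    apply smul_intro; unfold sinv; agpd; auto.
  - intros e (u & t & Hu & Ht & E & ->). unfold sinv. rewrite inv_cmp by auto.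
    apply smul_intro; agpd; auto.
Qed.

Lemma ssig_smul T U : ssig (smul T U) = smul (ssig T) (ssig U).
Proof.
  apply subset_ext.
  - intros e (t & u & Ht & Hu & E & E'). rewrite <- (sig_sig e), E', sig_cmp by auto.
    apply smul_intro; unfold ssig; agpd; auto. congruence.
  - intros e (u & t & Hu & Ht & E & ->). unfold ssig. rewrite sig_cmp by auto.
    apply smul_intro; agpd; auto. congruence.
Qed.

Lemma heap_smul T : heap T -> smul (smul T (sinv T)) T = T.
Proof.
  intros H. rewrite smul_assoc. apply subset_ext.
  - intros e (t1 & x & H1 & (t2 & t3 & H2 & H3 & E2 & ->) & E1 & ->).
    rewrite src_cmp in E1 by auto. rewrite <- (inv_inv t2).
    apply H; auto; agpd; auto.
  - intros e He. rewrite <- (cmp_K (u := e) (v := e)) by auto.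
    apply smul_intro; auto.
    + apply smul_intro; agpd; auto. unfold sinv; now rewrite inv_inv.
    + rewrite src_cmp; agpd; auto.
Qed.

Lemma heap_smul' T : heap T -> smul T (smul (sinv T) T) = T.
Proof. rewrite <- smul_assoc. apply heap_smul. Qed.

(** The second hypothesis is composability, the target of [T] being the source of [U]; the
    conclusion says that the product starts where [T] does. *)
Lemma smul_sinv_r T U : heap T -> smul (sinv T) T = smul U (sinv U) ->
  smul (smul T U) (smul (sinv U) (sinv T)) = smul T (sinv T).
Proof.
  intros H E.
  now rewrite smul_assoc, <- (smul_assoc U), <- E, <- smul_assoc, heap_smul'.
Qed.

Lemma smul_sinv_l T U : heap U -> smul (sinv T) T = smul U (sinv U) ->
  smul (smul (sinv U) (sinv T)) (smul T U) = smul (sinv U) U.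
Proof.
  intros H E.
  now rewrite smul_assoc, <- (smul_assoc (sinv T)), E, heap_smul.
Qed.
End SubsetCalculus.

Section DependentProduct.
Variables A B E : AGpd.
Variables (g : AHom A B) (q : AHom E A).
Hypotheses (Hg : sfib g) (Hq : sfib q).

(* An arrow of the dependent product over [b] is encoded as the set [T] of values of
   a section of [q] over the arrows of [A] above [b]; [heap T] says that this
   section is natural with respect to the sections over the ends of [b], which
   are then recovered as the sets [T T^-1] and [T^-1 T]. *)
Record pi_ok (bT : B * (E -> Prop)) : Prop := {
  pi_over : forall e, snd bT e -> g (q e) = fst bT;
  pi_ex : forall a, g a = fst bT -> exists e, snd bT e /\ q e = a;
  pi_inj : forall e e', snd bT e -> snd bT e' -> q e = q e' -> e = e';
  pi_src : forall e e', snd bT e -> snd bT e' -> src (q e) = src (q e') -> src e = src e';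
  pi_tgt : forall e e', snd bT e -> snd bT e' -> tgt (q e) = tgt (q e') -> tgt e = tgt e';
  pi_heap : heap (snd bT) }.

(** The object [tgt t] lies in [T^-1 T = U U^-1], so it is the source of some element of [U];
    [pi_src] identifies it with the source of [u]. *)
Lemma pi_match b c T U t u : pi_ok (b, T) -> pi_ok (c, U) ->
  smul (sinv T) T = smul U (sinv U) ->
  T t -> U u -> tgt (q t) = src (q u) -> tgt t = src u.
Proof.
  intros HT HU EQ Ht Hu E0.
  assert (M : smul (sinv T) T (cmp (inv t) t)).
  { apply smul_intro; agpd; auto. unfold sinv; now rewrite inv_inv. }
  rewrite EQ in M. destruct M as (u1 & u2 & H1 & H2 & H3 & H4).
  assert (S1 : src u1 = tgt t).
  { rewrite <- (src_cmp H3), <- H4, src_cmp; agpd; auto. }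
  rewrite <- S1. apply (pi_src HU); auto. rewrite <- amap_src, S1, amap_tgt. auto.
Qed.

Lemma pi_ok_inv b T : pi_ok (b, T) -> pi_ok (inv b, sinv T).
Proof.
  intros H; split; simpl; unfold sinv.
  - intros e He. assert (G := pi_over H He); simpl in G.
    now rewrite !amap_inv in G; rewrite <- G, inv_inv.
  - intros a Ha. destruct (pi_ex H (a := inv a)) as (e & E1 & E2).
    { simpl. rewrite amap_inv, Ha. apply inv_inv. }
    exists (inv e). rewrite inv_inv, amap_inv, E2, inv_inv. auto.
  - intros e e' He He' E0. rewrite <- (inv_inv e), <- (inv_inv e'). f_equal.
    apply (pi_inj H); auto. rewrite !amap_inv. congruence.
  - intros e e' He He' E0. rewrite <- (tgt_inv e), <- (tgt_inv e').
    apply (pi_tgt H); auto. rewrite !amap_inv, !tgt_inv. auto.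
  - intros e e' He He' E0. rewrite <- (src_inv e), <- (src_inv e').
    apply (pi_src H); auto. rewrite !amap_inv, !src_inv. auto.
  - intros t1 t2 t3 H1 H2 H3 E1 E2. unfold sinv in *.
    rewrite inv_cmp by gside.
    rewrite inv_cmp by gside.
    rewrite cmp_assoc by gside.
    apply (pi_heap H); simpl; auto; gside.
Qed.

Lemma pi_ok_sig b T : pi_ok (b, T) -> pi_ok (sig b, ssig T).
Proof.
  intros H; split; simpl; unfold ssig.
  - intros e He. assert (G := pi_over H He); simpl in G.
    now rewrite !amap_sig in G; rewrite <- G, sig_sig.
  - intros a Ha. destruct (pi_ex H (a := sig a)) as (e & E1 & E2).
    { simpl. rewrite amap_sig, Ha. apply sig_sig. }
    exists (sig e). rewrite sig_sig, amap_sig, E2, sig_sig. auto.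
  - intros e e' He He' E0. rewrite <- (sig_sig e), <- (sig_sig e'). f_equal.
    apply (pi_inj H); auto. rewrite !amap_sig. congruence.
  - intros e e' He He' E0. rewrite <- (sig_sig (src e)), <- (sig_sig (src e')). f_equal.
    rewrite !sig_src. apply (pi_src H); auto. rewrite !amap_sig, <- !sig_src. congruence.
  - intros e e' He He' E0. rewrite <- (sig_sig (tgt e)), <- (sig_sig (tgt e')). f_equal.
    rewrite !sig_tgt. apply (pi_tgt H); auto. rewrite !amap_sig, <- !sig_tgt. congruence.
  - intros t1 t2 t3 H1 H2 H3 E1 E2. unfold ssig in *.
    rewrite !sig_cmp, sig_inv by gside.
    apply (pi_heap H); simpl; auto; gside.
Qed.

Lemma pi_ok_cmp b c T U : pi_ok (b, T) -> pi_ok (c, U) -> tgt b = src c ->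
  smul (sinv T) T = smul U (sinv U) -> pi_ok (cmp b c, smul T U).
Proof.
  intros HT HU Ebc EQ.
  (* Elements of [T] with a common source differ by an element of [T^-1 T], rewritten here as a
     quotient of two elements of [U]. *)
  assert (quot : forall t t', T t -> T t' -> src t = src t' -> exists u1 u2, U u1 /\ U u2 /\
    tgt u1 = tgt u2 /\ tgt t' = src u1 /\ tgt t = src u2 /\ cmp (inv t') t = cmp u1 (inv u2)).
  { intros t t' Ht Ht' E0.
    assert (M : smul (sinv T) T (cmp (inv t') t)).
    { apply smul_intro; agpd; auto. unfold sinv; now rewrite inv_inv. }
    rewrite EQ in M. destruct M as (u1 & u2 & H1 & H2 & H3 & H4).
    exists u1, (inv u2). rewrite inv_inv, tgt_inv, src_inv. repeat split; auto.
    - rewrite <- (src_cmp H3), <- H4, src_cmp; agpd; auto.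
    - rewrite <- (tgt_cmp H3), <- H4, tgt_cmp; agpd; auto. }
  assert (mtch : forall t u, T t -> U u -> tgt (q t) = src (q u) -> tgt t = src u).
  { intros t u. now apply (pi_match HT HU). }
  split; simpl.
  - intros e (t & u & Ht & Hu & E0 & ->). rewrite !amap_cmp by gside.
    f_equal; [exact (pi_over HT Ht)|exact (pi_over HU Hu)].
  - intros a Ha.
    (* A lift [a1] of [b] splits [a] into [a1] above [b] and [a1^-1 a] above [c]. *)
    destruct (Hg (x := src a) (v := b)) as (a1 & A1 & A2).
    { apply src_src. } { rewrite amap_src, Ha, src_cmp; auto. }
    destruct (pi_ex HT A2) as (t & Ht & Et).
    destruct (pi_ex HU (a := cmp (inv a1) a)) as (u & Hu & Eu).
    { simpl. rewrite amap_cmp, amap_inv, A2, Ha by (agpd; auto). apply cmp_VK; auto. }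
    exists (cmp t u). assert (tgt t = src u).
    { apply mtch; auto. rewrite Et, Eu, src_cmp; agpd; auto. }
    split; [now apply smul_intro|]. rewrite amap_cmp, Et, Eu by auto. apply cmp_K; auto.
  - intros e e' (t & u & Ht & Hu & E0 & ->) (t' & u' & Ht' & Hu' & E0' & ->) EE.
    rewrite !amap_cmp in EE by auto.
    assert (S : src t = src t').
    { apply (pi_src HT); auto. apply (f_equal src) in EE.
      now rewrite !src_cmp in EE by gside. }
    destruct (quot t t' Ht Ht' S) as (u1 & u2 & H1 & H2 & H3 & H4 & H5 & H6).
    (* The elements [t] and [t'] may differ; their discrepancy is moved into [U], which the heap
       condition keeps stable. *)
    assert (W : cmp t u = cmp t' (cmp u1 (cmp (inv u2) u))).
    { rewrite <- (cmp_assoc (u := u1)), <- H6 by gside.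
      rewrite cmp_assoc by gside. rewrite cmp_K; auto. rewrite src_cmp; auto. }
    rewrite W. f_equal. apply (pi_inj HU); auto.
    { apply (pi_heap HU); simpl; auto; congruence. }
    apply cmp_cancel_l with (u := q t').
    + rewrite <- amap_tgt, <- amap_src, src_cmp; [congruence|]. rewrite src_cmp; gside.
    + rewrite <- amap_tgt, <- amap_src. congruence.
    + rewrite <- EE, <- !amap_cmp; auto; [congruence|]. rewrite !src_cmp; gside.
  - intros e e' (t & u & Ht & Hu & E0 & ->) (t' & u' & Ht' & Hu' & E0' & ->) EE.
    rewrite !src_cmp by auto. apply (pi_src HT); auto.
    now rewrite !amap_cmp, !src_cmp in EE by gside.
  - intros e e' (t & u & Ht & Hu & E0 & ->) (t' & u' & Ht' & Hu' & E0' & ->) EE.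
    rewrite !tgt_cmp by auto. apply (pi_tgt HU); auto.
    now rewrite !amap_cmp, !tgt_cmp in EE by gside.
  - intros e1 e2 e3 (t1 & u1 & Ht1 & Hu1 & E1 & ->) (t2 & u2 & Ht2 & Hu2 & E2 & ->)
      (t3 & u3 & Ht3 & Hu3 & E3 & ->) F1 F2.
    rewrite !tgt_cmp in F1 by auto. rewrite !src_cmp in F2 by auto.
    destruct (quot t3 t2 Ht3 Ht2 (eq_sym F2)) as (v & w & H1 & H2 & H3 & H4 & H5 & H6).
    assert (HX : U (cmp u1 (cmp (inv u2) v))) by (apply (pi_heap HU); simpl; auto; congruence).
    (* Replacing the inner [t2^-1 t3] by [v w^-1] leaves [t1] times an iterated heap operation in
       [U]. *)
    assert (EX : cmp (cmp t1 u1) (cmp (inv (cmp t2 u2)) (cmp t3 u3)) =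
      cmp t1 (cmp (cmp u1 (cmp (inv u2) v)) (cmp (inv w) u3))).
    { rewrite inv_cmp by auto. rewrite (cmp_assoc (v := inv t2)) by gside.
      rewrite <- (cmp_assoc (u := inv t2)), H6 by gside.
      rewrite !cmp_assoc by gside. reflexivity. }
    rewrite EX. apply smul_intro; auto.
    + apply (pi_heap HU); simpl; auto; rewrite ?tgt_cmp; gside.
    + rewrite !src_cmp; gside.
Qed.


Lemma pi_ok_src b T : pi_ok (b, T) -> pi_ok (src b, smul T (sinv T)).
Proof.
  intros H. rewrite <- cmp_inv_r. apply (pi_ok_cmp H (pi_ok_inv H)); agpd; auto.
  now rewrite sinv_sinv.
Qed.

Lemma pi_ok_tgt b T : pi_ok (b, T) -> pi_ok (tgt b, smul (sinv T) T).
Proof.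
  intros H. rewrite <- cmp_inv_l. apply (pi_ok_cmp (pi_ok_inv H) H); agpd; auto.
  now rewrite sinv_sinv.
Qed.

Definition pi_pre : PreAGpd.
Proof.
  refine {| par := B * (E -> Prop); ok := pi_ok;
    psrc := fun x => (src (fst x), smul (snd x) (sinv (snd x)));
    ptgt := fun x => (tgt (fst x), smul (sinv (snd x)) (snd x));
    pcmp := fun x y => (cmp (fst x) (fst y), smul (snd x) (snd y));
    pinv := fun x => (inv (fst x), sinv (snd x));
    psig := fun x => (sig (fst x), ssig (snd x)) |};
  repeat match goal with
  | |- forall _ : (_ * _)%type, _ => intros [? ?]
  | |- pi_ok _ -> _ => intros ?
  | |- (_, _) = (_, _) -> _ =>
      let H := fresh in intros H; pose proof (f_equal fst H); pose proof (f_equal snd H); clear H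
  end; simpl in *;
  try match goal with |- (_, _) = (_, _) => f_equal end;
  auto using pi_ok_src, pi_ok_tgt, pi_ok_cmp, pi_ok_inv, pi_ok_sig;
  repeat match goal with H : pi_ok _ |- _ => apply pi_heap in H; simpl in H end;
  rewrite ?sinv_smul, ?sinv_sinv, ?ssig_ssig, ?ssig_smul, ?ssig_sinv;
  try solve [agpd; congruence].
  - now rewrite <- smul_assoc, heap_smul.
  - now rewrite <- smul_assoc, heap_smul.
  - now rewrite smul_assoc, heap_smul'.
  - now rewrite smul_assoc, heap_smul'.
  - now apply smul_sinv_r.
  - now apply smul_sinv_l.
  - now apply cmp_assoc.
  - apply smul_assoc.
  - now apply heap_smul.
  - now apply heap_smul'.
Defined.

Definition pi_agpd : AGpd := restrict pi_pre.
Definition pi_set (x : pi_agpd) : E -> Prop := snd (restrict_val x).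

Definition pi_out : AHom pi_agpd B.
Proof.
  now refine (@from_restrict pi_pre B (fun x => fst x) _ _ _ _).
Defined.

Lemma pi_valid (x : pi_agpd) : pi_ok (pi_out x, pi_set x).
Proof. destruct x as [[b T] H]. exact H. Qed.

Lemma pi_ext (x y : pi_agpd) : pi_out x = pi_out y -> pi_set x = pi_set y -> x = y.
Proof.
  destruct x as [[b T] H], y as [[b' T'] H']; cbn. intros -> ->. now apply sig_eq.
Qed.

Lemma pi_set_src x : pi_set (src x) = smul (pi_set x) (sinv (pi_set x)).
Proof. reflexivity. Qed.

Lemma pi_set_tgt x : pi_set (tgt x) = smul (sinv (pi_set x)) (pi_set x).
Proof. reflexivity. Qed.

Lemma pi_set_sig x : pi_set (sig x) = ssig (pi_set x).
Proof. reflexivity. Qed.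

Lemma pi_set_cmp x y : tgt x = src y -> pi_set (cmp x y) = smul (pi_set x) (pi_set y).
Proof. intros H. unfold pi_set. now rewrite restrict_val_cmp. Qed.

Lemma pi_out_fib : sfib pi_out.
Proof.
  intros x b Hx Hb. pose proof (pi_valid x) as HS.
  pose proof (f_equal pi_set Hx) as HSS. rewrite pi_set_src in HSS.
  assert (Hb0 : src (pi_out x) = pi_out x) by now apply amap_obj.
  remember (pi_set x) as S eqn:ES. remember (pi_out x) as b0 eqn:Eb.
  assert (Ssrc : forall e, S e -> S (src e)).
  { intros e He. rewrite <- HSS, <- cmp_inv_r. apply smul_intro; agpd; auto.
    unfold sinv; now rewrite inv_inv. }
  assert (Stgt : forall e, S e -> S (tgt e)).
  { intros e He. rewrite <- HSS in He. destruct He as (e1 & e2 & H1 & H2 & E0 & ->).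
    rewrite tgt_cmp, <- src_inv by auto. apply Ssrc, H2. }
  set (I := {a' : A | g a' = tgt b /\ src a' = a'}).
  (* Given [a'] above the end of [b], an arrow [f] out of [a'] above [inv b] ends in the fibre where
     [S] is defined; the value of [S] there is transported to [a'] along a lift of [inv f] in
     [E]. *)
  destruct (choice (fun (a' : I) e =>
    tgt (q e) = proj1_sig a' /\ g (q e) = b /\ S (src e))) as [lift Hlift].
  { intros [a' [H1 H2]]; simpl.
    destruct (Hg (x := a') (v := inv b)) as (f & F1 & F2); auto.
    { now rewrite src_inv. }
    assert (G : g (tgt f) = b0).
    { rewrite amap_tgt, F2, tgt_inv, Hb. reflexivity. }
    destruct (pi_ex HS G) as (s & Hs & Es).
    assert (s = src s).
    { apply (pi_inj HS); simpl; auto. rewrite amap_src, Es, src_tgt; auto. }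
    destruct (Hq (x := s) (v := inv f)) as (e & E1 & E2); auto.
    { rewrite src_inv; auto. }
    exists e. rewrite E2, tgt_inv, amap_inv, F2, inv_inv, E1. auto. }
  assert (L1 : forall a', tgt (q (lift a')) = proj1_sig a') by apply Hlift.
  assert (L2 : forall a', g (q (lift a')) = b) by apply Hlift.
  assert (L3 : forall a', S (src (lift a'))) by apply Hlift.
  clear Hlift.
  (* An arrow above [b] is an arrow of the old fibre followed by the one chosen at its target, so
     its value is an element of [S] followed by a transport. *)
  set (T := fun e => exists a' u, S u /\ tgt u = src (lift a') /\ e = cmp u (lift a')).
  assert (same : forall (a1 a2 : I) u1 u2, tgt u1 = src (lift a1) -> tgt u2 = src (lift a2) ->
    tgt (q (cmp u1 (lift a1))) = tgt (q (cmp u2 (lift a2))) -> a1 = a2).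
  { intros a1 a2 u1 u2 H1 H2 H3. apply sig_eq.
    rewrite <- !amap_tgt, !tgt_cmp, !amap_tgt, !L1 in H3 by auto. exact H3. }
  assert (Tex : forall a, g a = b -> exists e, T e /\ q e = a).
  { intros a Ha.
    set (a' := exist _ (tgt a) (conj (eq_trans (amap_tgt g a) (f_equal tgt Ha)) (src_tgt a)) : I).
    assert (La : tgt a = tgt (q (lift a'))) by now rewrite L1.
    destruct (pi_ex HS (a := cmp a (inv (q (lift a'))))) as (u & Hu & Eu).
    { simpl. rewrite amap_cmp, amap_inv, L2, Ha by gside. rewrite cmp_inv_r. exact Hb. }
    assert (Hul : tgt u = src (lift a')).
    { rewrite <- (tgt_src (lift a')). apply (pi_tgt HS); simpl; auto. rewrite Eu.
      rewrite tgt_cmp, tgt_inv, amap_src, tgt_src; gside. }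
    exists (cmp u (lift a')). split; [exists a', u; auto|].
    rewrite amap_cmp, Eu, cmp_assoc, cmp_inv_l, <- La by gside. apply cmp_tgt. }
  assert (HT : pi_ok (b, T)).
  { split; simpl; auto.
    - intros e (a' & u & H1 & H2 & ->). rewrite !amap_cmp, L2 by gside.
      rewrite (pi_over HS H1). simpl. apply cmp_obj_l; congruence.
    - intros e e' (a' & u & H1 & H2 & ->) (a2 & u' & H1' & H2' & ->) EE.
      assert (a2 = a') by (apply same with u' u; congruence). subst a2. f_equal.
      apply (pi_inj HS); simpl; auto. rewrite !amap_cmp in EE by auto.
      apply cmp_cancel_r in EE; auto; rewrite <- amap_tgt, <- amap_src; congruence.
    - intros e e' (a' & u & H1 & H2 & ->) (a2 & u' & H1' & H2' & ->) EE.
      rewrite !src_cmp by auto. apply (pi_src HS); simpl; auto.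
      now rewrite <- !amap_src, !src_cmp, !amap_src in EE by auto.
    - intros e e' (a' & u & H1 & H2 & ->) (a2 & u' & H1' & H2' & ->) EE.
      assert (a2 = a') by (apply same with u' u; congruence). subst a2.
      now rewrite !tgt_cmp by auto.
    - intros e1 e2 e3 (a1 & u1 & H1 & E1 & ->) (a2 & u2 & H2 & E2 & ->) (a3 & u3 & H3 & E3 & ->).
      intros F1 F2.
      assert (a1 = a2).
      { apply same with u1 u2; auto. now rewrite <- !amap_tgt, F1. } subst a2.
      rewrite !src_cmp in F2 by auto.
      exists a3, (cmp u1 (cmp (inv u2) u3)). split; [|split].
      + apply (pi_heap HS); simpl; auto; congruence.
      + rewrite !tgt_cmp; gside.
      + rewrite inv_cmp by auto.
        rewrite (cmp_assoc (u := u1)), (cmp_assoc (u := inv (lift a1))) by gside.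
        rewrite cmp_K by gside. rewrite !cmp_assoc by gside. reflexivity. }
  exists (@restrict_mk pi_pre (b, T) HT). split; [|reflexivity].
  apply pi_ext; [exact (eq_trans Hb Eb)|]. rewrite pi_set_src, <- ES. change (smul T (sinv T) = S).
  apply subset_ext.
  - intros e (e1 & e2 & (a1 & u1 & H1 & E1 & ->) & (a2 & u2 & H2 & E2 & E2') & F & ->).
    assert (E3 : e2 = inv (cmp u2 (lift a2))) by now rewrite <- E2', inv_inv.
    clear E2'. subst e2.
    rewrite tgt_cmp, src_inv, tgt_cmp in F by auto.
    assert (a1 = a2).
    { apply same with u1 u2; auto. now rewrite <- !amap_tgt, !tgt_cmp, F by auto. }
    subst a2. rewrite inv_cmp by auto.
    rewrite cmp_assoc by gside. rewrite cmp_K by gside.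
    rewrite <- HSS. apply smul_intro; agpd; auto; [|congruence].
    unfold sinv; now rewrite inv_inv.
  (* Here [s] is written as [(s e) e^-1] with [e] in [T] starting at [tgt s]; such an [e] comes from
     lifting [b] along [g] at [tgt (q s)]. *)
  - intros s Hs.
    assert (Hgs : g (q s) = b0) by exact (pi_over HS Hs).
    assert (Hst : g (tgt (q s)) = b0).
    { rewrite amap_tgt, Hgs. now apply tgt_obj. }
    destruct (Hg (x := tgt (q s)) (v := b)) as (a & A1 & A2).
    { apply src_tgt. } { congruence. }
    destruct (Tex a A2) as (e & He & Ee). destruct He as (a' & u & Hu & Eu & ->).
    assert (Hsu : tgt s = src u).
    { rewrite <- (tgt_src u). apply (pi_tgt HS); simpl; auto.
      rewrite amap_src, tgt_src. rewrite <- A1, <- Ee, <- amap_src, src_cmp, amap_src; auto. }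
    rewrite <- (cmp_tgt s), Hsu, <- (src_cmp Eu), <- cmp_inv_r.
    rewrite <- cmp_assoc by gside. rewrite <- (cmp_assoc (u := s)) by auto.
    apply smul_intro.
    + exists a', (cmp s u). split; [|split; [rewrite tgt_cmp; auto|reflexivity]].
      rewrite <- (cmp_src u), <- (inv_obj (u := src u)) by apply src_src.
      apply (pi_heap HS); simpl; auto; agpd; auto.
    + unfold sinv. rewrite inv_inv. exists a', u; auto.
    + agpd; congruence.
Qed.

Section Evaluation.
Variables (Q : AGpd) (gP : AHom Q pi_agpd) (r' : AHom Q A).
Hypothesis HQ : apullback pi_out g gP r'.

(** The counit evaluates the section [gP w] at [r' w]. By [pi_inj] the value is unique, which
    reduces each law of a homomorphism to a membership. *)
Lemma pi_eval_ex : exists eps : AHom Q E,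
  forall w, pi_set (gP w) (eps w) /\ q (eps w) = r' w.
Proof.
  destruct HQ as (Hc & _ & _).
  destruct (choice (fun w e => pi_set (gP w) e /\ q e = r' w)) as [eps Heps].
  { intros w. apply (pi_ex (pi_valid (gP w))). symmetry. apply Hc. }
  assert (H1 : forall w, pi_set (gP w) (eps w)) by apply Heps.
  assert (H2 : forall w, q (eps w) = r' w) by apply Heps.
  assert (K : forall w e, pi_set (gP w) e -> q e = r' w -> eps w = e).
  { intros w e He Hqe. apply (pi_inj (pi_valid (gP w))); simpl; auto. congruence. }
  unshelve eexists {| amap := eps |}; [..|exact Heps].
  - intros w. apply K; [|now rewrite !amap_src, H2].
    rewrite amap_src, pi_set_src, <- cmp_inv_r. apply smul_intro; agpd; auto.
    unfold sinv; now rewrite inv_inv.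
  - intros w. apply K; [|now rewrite !amap_tgt, H2].
    rewrite amap_tgt, pi_set_tgt, <- cmp_inv_l. apply smul_intro; agpd; auto.
    unfold sinv; now rewrite inv_inv.
  - intros w w' E0. assert (E1 : tgt (gP w) = src (gP w')) by now rewrite <- amap_tgt, <- amap_src, E0.
    assert (E2 : tgt (eps w) = src (eps w')).
    { apply (pi_match (pi_valid (gP w)) (pi_valid (gP w'))); auto.
      - rewrite <- pi_set_tgt, <- pi_set_src. congruence.
      - rewrite !H2, <- amap_tgt, <- amap_src. congruence. }
    apply K; [|rewrite !amap_cmp, !H2; auto].
    rewrite amap_cmp, pi_set_cmp by auto. now apply smul_intro.
  - intros w. apply K; [|now rewrite !amap_sig, H2].
    rewrite amap_sig, pi_set_sig. unfold ssig. now rewrite sig_sig.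
Qed.
End Evaluation.

(** * Transposition and the universal property *)

Section Transpose.
Variables (X Y : AGpd) (h : AHom X B) (gX : AHom Y X) (h' : AHom Y A) (phi : AHom Y E).
Hypotheses (HY : apullback h g gX h') (Hphi : forall y, q (phi y) = h' y).

Definition transpose_set (x : X) : E -> Prop := fun e => exists y, gX y = x /\ phi y = e.

Lemma transpose_ok x : pi_ok (h x, transpose_set x).
Proof.
  destruct HY as (Hc & Hi & He). split; simpl.
  - intros e (y & <- & <-). now rewrite Hphi.
  - intros a Ha. destruct (He x a) as (y & Y1 & Y2); auto.
    exists (phi y). split; [exists y; auto|congruence].
  - intros e e' (y & Y1 & <-) (y' & Y1' & <-). rewrite !Hphi. intros E0.
    f_equal. apply Hi; congruence.
  - intros e e' (y & Y1 & <-) (y' & Y1' & <-). rewrite !Hphi. intros E0.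
    rewrite <- !amap_src. f_equal. apply Hi; rewrite !amap_src; congruence.
  - intros e e' (y & Y1 & <-) (y' & Y1' & <-). rewrite !Hphi. intros E0.
    rewrite <- !amap_tgt. f_equal. apply Hi; rewrite !amap_tgt; congruence.
  - intros e1 e2 e3 (y1 & Y1 & <-) (y2 & Y2 & <-) (y3 & Y3 & <-) F1 F2.
    assert (F1' : tgt y1 = tgt y2).
    { apply Hi; rewrite !amap_tgt; [congruence|]. rewrite <- !Hphi, <- !(amap_tgt q). congruence. }
    assert (F2' : src y2 = src y3).
    { apply Hi; rewrite !amap_src; [congruence|]. rewrite <- !Hphi, <- !(amap_src q). congruence. }
    exists (cmp y1 (cmp (inv y2) y3)). rewrite !amap_cmp, !amap_inv by gside. split; auto.
    rewrite Y1, Y2, Y3, cmp_inv_l. apply cmp_tgt.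
Qed.

Lemma transpose_cmp x x' : tgt x = src x' ->
  transpose_set (cmp x x') = smul (transpose_set x) (transpose_set x').
Proof.
  intros Ex. destruct HY as (Hc & Hi & He). apply subset_ext.
  - intros e (y & Y1 & <-).
    (* An arrow of [Y] above [cmp x x'] is split by lifting [h x] along [g]: the lift paired with
       [x] gives the first factor [y1]. *)
    destruct (Hg (x := h' (src y)) (v := h x)) as (a & A1 & A2).
    { apply amap_obj, src_src. }
    { rewrite <- Hc, !amap_src, Y1, <- !amap_src, src_cmp; auto. }
    destruct (He x a) as (y1 & Z1 & Z2); auto.
    assert (S1 : src y1 = src y).
    { apply Hi; rewrite !amap_src; [rewrite Z1, Y1, src_cmp; auto|].
      rewrite Z2, A1. now rewrite amap_src. }
    rewrite <- (cmp_K S1), amap_cmp by gside. apply smul_intro; [exists y1; auto| |].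
    + exists (cmp (inv y1) y). split; auto. rewrite amap_cmp, amap_inv, Y1, Z1 by gside.
      now apply cmp_VK.
    + rewrite <- amap_tgt, <- amap_src. gside.
  - intros e (e1 & e2 & (y1 & Y1 & <-) & (y2 & Y2 & <-) & F & ->).
    assert (F' : tgt y1 = src y2).
    { apply Hi; rewrite amap_src, amap_tgt; [congruence|].
      rewrite <- !Hphi, <- amap_tgt, <- amap_src. congruence. }
    exists (cmp y1 y2). rewrite !amap_cmp by auto. split; congruence.
Qed.

Lemma transpose_inv x : transpose_set (inv x) = sinv (transpose_set x).
Proof.
  apply subset_ext; unfold sinv.
  - intros e (y & Y1 & <-). exists (inv y). rewrite !amap_inv, Y1, inv_inv. auto.
  - intros e (y & Y1 & Y2). exists (inv y). rewrite !amap_inv, Y1, Y2, inv_inv. auto.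
Qed.

Lemma transpose_sig x : transpose_set (sig x) = ssig (transpose_set x).
Proof.
  apply subset_ext; unfold ssig.
  - intros e (y & Y1 & <-). exists (sig y). rewrite !amap_sig, Y1, sig_sig. auto.
  - intros e (y & Y1 & Y2). exists (sig y). rewrite !amap_sig, Y1, Y2, sig_sig. auto.
Qed.

Definition transpose : AHom X pi_agpd.
Proof.
  refine (@into_restrict pi_pre X (fun x => (h x, transpose_set x)) transpose_ok _ _ _ _);
    simpl; intros; f_equal; auto using amap_src, amap_tgt, amap_cmp, amap_sig,
      transpose_cmp, transpose_sig.
  - rewrite <- cmp_inv_r, transpose_cmp, transpose_inv by gside. reflexivity.
  - rewrite <- cmp_inv_l, transpose_cmp, transpose_inv by gside. reflexivity.
Defined.

Lemma pi_out_transpose x : pi_out (transpose x) = h x.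
Proof. reflexivity. Qed.

(** Evaluating [k2] along [gX] puts every [phi y] in the set of [k2 (gX y)]. Conversely each element
    of that set is determined by its image in [A], which some [y] attains. *)
Lemma transpose_unique (Q : AGpd) (gP : AHom Q pi_agpd) (r' : AHom Q A) (eps : AHom Q E)
    (k2 : AHom X pi_agpd) :
  apullback pi_out g gP r' ->
  (forall w, pi_set (gP w) (eps w) /\ q (eps w) = r' w) ->
  (forall x, pi_out (k2 x) = h x) ->
  (forall k' : AHom Y Q, (forall y, gP (k' y) = k2 (gX y)) -> (forall y, r' (k' y) = h' y) ->
    forall y, eps (k' y) = phi y) ->
  forall x, k2 x = transpose x.
Proof.
  intros HQ Heps Hk2 Hu x. destruct HY as (Hc & Hi & He).
  destruct (apullback_pair HQ (u := comp_ahom k2 gX) (v := h')) as (k' & K1 & K2).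
  { intros y. change (pi_out (k2 (gX y)) = g (h' y)). now rewrite Hk2, Hc. }
  simpl in K1. specialize (Hu k' K1 K2).
  assert (M : forall y, pi_set (k2 (gX y)) (phi y)).
  { intros y. rewrite <- K1, <- Hu. apply Heps. }
  apply pi_ext; [apply Hk2|]. apply subset_ext.
  - intros e Hx. pose proof (pi_valid (k2 x)) as V.
    assert (Hge : g (q e) = h x) by (rewrite <- Hk2; exact (pi_over V Hx)).
    destruct (He x (q e)) as (y & Y1 & Y2); auto.
    exists y. split; auto. apply (pi_inj V); simpl; auto.
    + rewrite <- Y1. apply M.
    + now rewrite Hphi.
  - intros e (y & <- & <-). apply M.
Qed.

Lemma transpose_eval (Q : AGpd) (gP : AHom Q pi_agpd) (r' : AHom Q A) (eps : AHom Q E)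
    (k' : AHom Y Q) :
  (forall w, pi_set (gP w) (eps w) /\ q (eps w) = r' w) ->
  (forall y, gP (k' y) = transpose (gX y)) -> (forall y, r' (k' y) = h' y) ->
  forall y, eps (k' y) = phi y.
Proof.
  intros Heps H1 H2 y. destruct (Heps (k' y)) as [E1 E2].
  apply (pi_inj (pi_valid (gP (k' y)))); simpl; auto.
  - rewrite H1. exists y; auto.
  - rewrite E2, H2. now rewrite Hphi.
Qed.
End Transpose.
End DependentProduct.

(** * The fibration category *)

Lemma is_pullback_of_apullback (A B D P : Ob GpdG) (f : Hom GpdG A D) (g : Hom GpdG B D)
    (pa : Hom GpdG P A) (pb : Hom GpdG P B) :
  apullback (arrow_map f) (arrow_map g) (arrow_map pa) (arrow_map pb) -> is_pullback f g pa pb.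
Proof.
  intros H. split.
  - apply heqE. intros w. apply H.
  - intros W u v E. rewrite heqE in E.
    destruct (apullback_pair H (u := arrow_map u) (v := arrow_map v) E) as (m & M1 & M2).
    destruct (arrow_map_full m) as [k Hk].
    exists k. rewrite !heqE. repeat split.
    + intros w. now rewrite arrow_map_comp, Hk.
    + intros w. now rewrite arrow_map_comp, Hk.
    + intros k'. rewrite !heqE. intros E1 E2 w. apply H.
      * rewrite Hk, M1. apply E1.
      * rewrite Hk, M2. apply E2.
Qed.

Lemma pullback_exists (A B D : Ob GpdG) (f : Hom GpdG A D) (g : Hom GpdG B D) :
  exists P (pa : Hom GpdG P A) (pb : Hom GpdG P B),
    apullback (arrow_map f) (arrow_map g) (arrow_map pa) (arrow_map pb).
Proof.
  set (S := restrict (pb_agpd (arrow_map f) (arrow_map g))).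
  destruct (arrow_map_full (Y := A) (comp_ahom (pb_fst _ _) (realize_to S))) as [pa Ha].
  destruct (arrow_map_full (Y := B) (comp_ahom (pb_snd _ _) (realize_to S))) as [pb Hb].
  exists (realize S), pa, pb.
  destruct (pb_apullback (arrow_map f) (arrow_map g)) as (Hc & Hi & He).
  split; [|split].
  - intros w. rewrite Ha, Hb. apply Hc.
  - intros w w'. rewrite !Ha, !Hb. intros E1 E2.
    rewrite <- (realize_toK w), <- (realize_toK w'). f_equal. now apply Hi.
  - intros a b E. destruct (He a b E) as (w & W1 & W2).
    exists (realize_of S w). rewrite Ha, Hb; cbn -[realize_to realize_of].
    rewrite !realize_ofK. auto.
Qed.

(** Comparison with the constructed pullback: the map [m] into it has the left inverse [k], which
    gives joint injectivity, and [k] itself supplies the preimages. *)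
Lemma apullback_of_is_pullback (A B D P : Ob GpdG) (f : Hom GpdG A D) (g : Hom GpdG B D)
    (pa : Hom GpdG P A) (pb : Hom GpdG P B) :
  is_pullback f g pa pb -> apullback (arrow_map f) (arrow_map g) (arrow_map pa) (arrow_map pb).
Proof.
  intros [Hc Hu].
  destruct (pullback_exists f g) as (C & ca & cb & HC).
  destruct (is_pullback_of_apullback HC) as [Cc Cu].
  destruct (Cu P pa pb Hc) as (m & M1 & M2 & _).
  destruct (Hu C ca cb Cc) as (k & K1 & K2 & _).
  destruct (Hu P pa pb Hc) as (k0 & _ & _ & K0).
  rewrite heqE in *.
  assert (KM : forall w, arrow_map k (arrow_map m w) = w).
  { assert (E1 : k ⊙ m ≈ k0).
    { apply K0; apply heqE; intros w; rewrite !arrow_map_comp.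
      - rewrite <- arrow_map_comp, K1. apply M1.
      - rewrite <- arrow_map_comp, K2. apply M2. }
    assert (E2 : idm P ≈ k0).
    { apply K0; apply heqE; intros w; now rewrite arrow_map_comp, arrow_map_id. }
    rewrite heqE in E1, E2. intros w. rewrite <- arrow_map_comp, E1, <- E2. apply arrow_map_id. }
  split; [|split].
  - exact Hc.
  - intros w w' E1 E2. rewrite <- (KM w), <- (KM w'). f_equal. apply HC.
    + etransitivity; [apply M1|]. symmetry. etransitivity; [apply M1|]. auto.
    + etransitivity; [apply M2|]. symmetry. etransitivity; [apply M2|]. auto.
  - intros a b E. destruct HC as (_ & _ & He). destruct (He a b E) as (w & W1 & W2).
    exists (arrow_map k w). split; [rewrite <- W1; apply K1|rewrite <- W2; apply K2].
Qed.

(** The comparison [t] is exported because [acof_of_section] expects a section with values in [fac]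
    itself. *)
Lemma factorization_exists (X Y : Ob GpdG) (f : Hom GpdG X Y) :
  exists Z (i : Hom GpdG X Z) (p : Hom GpdG Z Y) (t : AHom (arrows Z) (restrict (fac (arrow_map f)))),
    acof (arrow_map i) /\ projective_fib p /\
    (forall u, t (arrow_map i u) = fac_in (arrow_map f) u) /\
    (forall w, arrow_map p w = fac_out (arrow_map f) (t w)).
Proof.
  set (S := restrict (fac (arrow_map f))).
  destruct (arrow_map_full (X := X) (comp_ahom (realize_of S) (fac_in _))) as [i Hi].
  destruct (arrow_map_full (Y := Y) (comp_ahom (fac_out _) (realize_to S))) as [p Hp].
  change (forall u, arrow_map i u = realize_of S (fac_in _ u)) in Hi.
  change (forall w, arrow_map p w = fac_out _ (realize_to S w)) in Hp.
  exists (realize S), i, p, (realize_to S). repeat split.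
  - intros u v E. apply (fac_in_acof (arrow_map f)).
    apply (f_equal (realize_to S)) in E. rewrite !Hi in E. exact E.
  - intros w a a' Hs Ht.
    destruct (fac_in_acof (arrow_map f)) as (_ & Hf & _).
    destruct (Hf (realize_to S w) a a') as [u Hu].
    + rewrite <- amap_src, Hs, Hi. apply realize_ofK.
    + rewrite <- amap_tgt, Ht, Hi. apply realize_ofK.
    + exists u. rewrite Hi, Hu. apply realize_toK.
  - intros b Hb. destruct (fac_in_acof (arrow_map f)) as (_ & _ & Ho).
    destruct (Ho (realize_to S b)) as [[a Ha]|(Hn & a & k & K1 & K2)].
    + now apply amap_obj.
    + left. exists a. rewrite Hi, Ha. apply realize_toK.
    + right. split.
      * intros E. apply Hn. now rewrite <- amap_sig, E.
      * fold S in k, K1, K2. exists a, (realize_of S k). rewrite <- amap_src, <- amap_tgt, K1, K2, Hi.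
        split; [reflexivity|apply realize_toK].
  - apply projective_fibE. intros x v Hx Hv.
    destruct (@fac_out_fib _ _ (arrow_map f) (realize_to S x) v) as (u & U1 & U2).
    + now apply amap_obj.
    + rewrite Hv, Hp. reflexivity.
    + fold S in u, U1, U2. exists (realize_of S u). rewrite <- amap_src, U1, realize_toK, Hp. auto.
  - intros u. now rewrite Hi.
  - apply Hp.
Qed.

Lemma acyclic_cofE (A B : Ob GpdG) (i : Hom GpdG A B) :
  acyclic_cof projective_fib i <-> acof (arrow_map i).
Proof.
  split.
  - intros H. destruct (factorization_exists i) as (Z & j & p & t & Hj & Hp & Tj & Tp).
    (* The square has [j] on top and an identity below, so that its diagonal is a section of [p]
       extending [j]. *)
    destruct (H Z B p Hp j (idm B)) as (h & H1 & H2).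
    { apply heqE. intros a. rewrite !arrow_map_comp, arrow_map_id, Tp, Tj. apply fac_out_in. }
    rewrite heqE in H1, H2.
    apply (acof_of_section (h := comp_ahom t (arrow_map h))).
    + intros a. exact (eq_trans (f_equal t (H1 a)) (Tj a)).
    + intros b. change (fac_out (arrow_map i) (t (arrow_map h b)) = b).
      rewrite <- Tp. etransitivity; [apply H2|apply arrow_map_id].
  - intros H X Y p Hp u v E. apply projective_fibE in Hp. rewrite heqE in E.
    destruct (acof_lift H Hp (u := arrow_map u) (v := arrow_map v) E) as (m & M1 & M2).
    destruct (arrow_map_full m) as [h Hh].
    exists h. split; apply heqE; intros w; rewrite arrow_map_comp, Hh; auto.
Qed.

Definition unit_agpd : AGpd.
Proof.
  refine {| ar := unit; src := fun u => u; tgt := fun u => u; cmp := fun u _ => u;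
    inv := fun u => u; sig := fun u => u |}; auto.
Defined.

Lemma terminal_exists : exists (t : Ob GpdG) (z : arrows t), forall u, u = z.
Proof.
  exists (realize unit_agpd), (realize_of unit_agpd tt). intros u.
  rewrite <- (realize_toK u). f_equal. now destruct (realize_to unit_agpd u).
Qed.

Lemma dependent_product (A B E : Ob GpdG) (g : Hom GpdG A B) (q : Hom GpdG E A) :
  projective_fib g -> projective_fib q ->
  exists P (r : Hom GpdG P B) Q (gP : Hom GpdG Q P) (r' : Hom GpdG Q A) (eps : Hom GpdG Q E),
    projective_fib r /\ is_pullback r g gP r' /\ q ⊙ eps ≈ r' /\
    forall X (h : Hom GpdG X B) Y (gX : Hom GpdG Y X) (h' : Hom GpdG Y A),
      is_pullback h g gX h' ->
      forall phi : Hom GpdG Y E, q ⊙ phi ≈ h' ->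
      exists k : Hom GpdG X P,
        r ⊙ k ≈ h /\
        (forall k' : Hom GpdG Y Q, gP ⊙ k' ≈ k ⊙ gX -> r' ⊙ k' ≈ h' -> eps ⊙ k' ≈ phi) /\
        (forall k2 : Hom GpdG X P, r ⊙ k2 ≈ h ->
          (forall k' : Hom GpdG Y Q, gP ⊙ k' ≈ k2 ⊙ gX -> r' ⊙ k' ≈ h' -> eps ⊙ k' ≈ phi) ->
          k2 ≈ k).
Proof.
  rewrite !projective_fibE. intros Hg Hq.
  set (S := pi_agpd (arrow_map q) Hg).
  destruct (arrow_map_full (Y := B) (comp_ahom (pi_out (arrow_map q) Hg) (realize_to S))) as [r Hr].
  change (forall w, arrow_map r w = pi_out (arrow_map q) Hg (realize_to S w)) in Hr.
  destruct (pullback_exists r g) as (Q & gP & r' & HQ).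
  set (t := comp_ahom (realize_to S) (arrow_map gP)).
  (* [Q] is a pullback of [r]; composing [gP] with the isomorphism [realize_to S] turns it into a
     pullback of [pi_out], on which evaluation is defined. *)
  assert (HQ' : apullback (pi_out (arrow_map q) Hg) (arrow_map g) t (arrow_map r')).
  { destruct HQ as (Qc & Qi & Qe). split; [|split].
    - intros w. rewrite <- Qc, Hr. reflexivity.
    - intros w w' E1 E2. apply Qi; auto.
      rewrite <- (realize_toK (arrow_map gP w)), <- (realize_toK (arrow_map gP w')).
      f_equal. exact E1.
    - intros x a E1. destruct (Qe (realize_of S x) a) as (w & W1 & W2).
      { rewrite Hr, realize_ofK. exact E1. }
      exists w. split; auto. exact (eq_trans (f_equal (realize_to S) W1) (realize_ofK x)). }
  destruct (pi_eval_ex HQ') as [m Hm].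
  destruct (arrow_map_full m) as [eps Heps].
  exists (realize S), r, Q, gP, r', eps. split; [|split; [|split]].
  - apply projective_fibE. intros x v Hx Hv. rewrite Hr in Hv.
    destruct (pi_out_fib Hq (x := realize_to S x) (v := v)) as (u & U1 & U2); auto.
    { now apply amap_obj. }
    fold S in u, U1, U2. exists (realize_of S u).
    rewrite <- amap_src, U1, realize_toK, Hr, realize_ofK. auto.
  - now apply is_pullback_of_apullback.
  - apply heqE. intros w. rewrite arrow_map_comp, Heps. apply Hm.
  - intros X h Y gX h' HY phi Hphi. apply apullback_of_is_pullback in HY.
    assert (Hphi' : forall y, arrow_map q (arrow_map phi y) = arrow_map h' y) by exact (proj1 (heqE _ _) Hphi).
    set (tr := transpose Hg HY Hphi').
    destruct (arrow_map_full (comp_ahom (realize_of S) tr)) as [k Hk].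
    change (forall x, arrow_map k x = realize_of S (tr x)) in Hk.
    exists k. split; [|split].
    + apply heqE. intros x. rewrite arrow_map_comp, Hk, Hr, realize_ofK. apply pi_out_transpose.
    + intros k' E1 E2. rewrite heqE in *. intros y. rewrite arrow_map_comp, Heps.
      apply (transpose_eval (HY := HY) (Hphi := Hphi') (gP := t) (r' := arrow_map r')
        (k' := arrow_map k')); auto.
      intros w. exact (eq_trans (f_equal (realize_to S) (eq_trans (E1 w) (Hk (arrow_map gX w))))
        (realize_ofK (tr (arrow_map gX w)))).
    + intros k2 E1 Hu. rewrite heqE in *. intros x. rewrite Hk.
      rewrite <- (realize_toK (arrow_map k2 x)). f_equal.
      refine (transpose_unique HY Hphi'
        (k2 := comp_ahom (realize_to S) (arrow_map k2)) HQ' Hm _ _ x).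
      * intros w. etransitivity; [symmetry; apply Hr|]. apply E1.
      * intros k' K1 K2 y. destruct (arrow_map_full k') as [k1 Hk1].
        rewrite <- Heps, <- Hk1. specialize (Hu k1). rewrite !heqE in Hu. apply Hu.
        -- intros w. rewrite !arrow_map_comp, Hk1.
           rewrite <- (realize_toK (arrow_map gP _)), <- (realize_toK (arrow_map k2 _)).
           f_equal. apply K1.
        -- intros w. now rewrite arrow_map_comp, Hk1.
Qed.

Theorem theorem4p14 : is_ttfc GpdG projective_fib.
Proof.
  split; [|split; [|split; [|split; [|split; [|split; [|split; [|split; [|split; [|split]]]]]]]]].
  - unfold is_category. repeat split; intros *; rewrite ?heqE; auto.
    + intros H1 H2 u. now rewrite H1.
    + intros H1 H2 u. now rewrite !arrow_map_comp, H1, H2.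
  - destruct terminal_exists as (t & z & Ht). exists t. split.
    + intros X.
      assert (c : AHom (arrows X) (arrows t)).
      { refine {| amap := fun _ => z |}; intros; symmetry; apply Ht. }
      destruct (arrow_map_full c) as [f _]. exists f. intros f'. apply heqE.
      intros u. now rewrite (Ht (arrow_map f u)).
    + intros X f. apply projective_fibE. intros x v Hx _. exists x. rewrite (Ht v). auto.
  - intros a b f f' E. rewrite !projective_fibE, heqE in *. intros Hf x v Hx Hv.
    destruct (Hf x v) as (u & U1 & U2); [auto|now rewrite E|].
    exists u. rewrite <- E. auto.
  - intros a. apply projective_fibE. intros x v Hx Hv. rewrite arrow_map_id in Hv.
    exists v. rewrite arrow_map_id. auto.
  - intros a b c f g. rewrite !projective_fibE. intros Hf Hg x v Hx Hv.
    destruct (Hg (arrow_map f x) v) as (w & W1 & W2); [now apply amap_obj|auto|].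
    destruct (Hf x w) as (u & U1 & U2); auto.
    exists u. rewrite arrow_map_comp, U2. auto.
  - intros a b f [f' [E1 E2]]. rewrite heqE in *. apply projective_fibE.
    apply iso_sfib with (g := arrow_map f').
    + intros x. rewrite <- arrow_map_comp, E1. apply arrow_map_id.
    + intros x. rewrite <- arrow_map_comp, E2. apply arrow_map_id.
  - intros A B D p h _. destruct (pullback_exists h p) as (P & p1 & p2 & H).
    exists P, p1, p2. now apply is_pullback_of_apullback.
  - intros A B D P p h p1 p2. rewrite !projective_fibE. intros Hp H.
    apply apullback_of_is_pullback in H. exact (apullback_fib Hp H).
  - intros A B g Hg E q Hq. now apply dependent_product.
  - intros X Y f. destruct (factorization_exists f) as (Z & i & p & t & Hi & Hp & Ti & Tp).
    exists Z, i, p. split; [now apply acyclic_cofE|split; [auto|]].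
    apply heqE. intros u. rewrite arrow_map_comp, Tp, Ti. apply fac_out_in.
  - intros A B D p q i Hp Hq Hi E Z z Y y1 y2 HY X x1 x2 HX.
    apply acyclic_cofE. apply acyclic_cofE in Hi. apply projective_fibE in Hq.
    rewrite heqE in E. apply apullback_of_is_pullback in HY, HX.
    exact (acof_pullback Hq (p := arrow_map p) (i := arrow_map i) E Hi HY HX).
Qed.
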